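(* Fix $0<p<1/2$. Let $\mu$ be a finite positive measure supported on a closed set $E\subset\partial\mathbb{D}$ of zero length whose complementary arcs $\{J\}$ satisfy $$\sum_J|J|^{1-q}<\infty$$ for some $q>\frac{p}{1-p}$. Then $S_\mu'\in H^p$.
   Context: $\mathbb{D}$ is the open unit disk, $\partial\mathbb{D}$ the unit circle, $|J|$ is the length of an arc $J$, and $H^p$ is the Hardy space on $\mathbb{D}$. The complementary arcs of $E$ are the connected components of $\partial\mathbb{D}\setminus E$. For a finite positive singular measure $\mu$ on $\partial\mathbb{D}$, the singular inner function is $$S_\mu(z)=\exp\Bigl(-\int_{\partial\mathbb{D}}\frac{\zeta+z}{\zeta-z}\,d\mu(\zeta)\Bigr),\qquad |z|<1.$$ *)

(* Defs.v *)
From HB Require Import structures.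
From mathcomp Require Import all_boot all_order all_algebra.
From mathcomp Require Import all_classical all_reals all_analysis.
From mathcomp Require Import complex.
Set Implicit Arguments.
Unset Strict Implicit.
Unset Printing Implicit Defensive.
Import Order.TTheory GRing.Theory Num.Theory numFieldNormedType.Exports.
Local Open Scope classical_set_scope.
Local Open Scope ring_scope.
Local Open Scope complex_scope.

(* R[i] as a normed space over itself, so that [derivable f z 1] and
   [derive1 f z] are complex differentiability and the complex derivative. *)
#[non_forgetful_inheritance]
HB.instance Definition _ (R : realType) := GRing.ComAlgebra.copy R[i] R[i]^o.
#[non_forgetful_inheritance]
HB.instance Definition _ (R : realType) := Vector.copy R[i] R[i]^o.
#[non_forgetful_inheritance]
HB.instance Definition _ (R : realType) := NormedModule.copy R[i] R[i]^o.

(* The Borel sigma-algebra of the plane. *)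
HB.instance Definition _ (R : realType) :=
  Measurable.copy R[i] (g_sigma_algebraType (@open R[i])).

Section Disk.
Variable R : realType.

Definition unit_disk : set R[i] := [set z | `|z| < 1].

Definition unit_circle : set R[i] := [set z | `|z| = 1].

Definition expC (z : R[i]) : R[i] :=
  (expR (complex.Re z) * cos (complex.Im z))
  +i* (expR (complex.Re z) * sin (complex.Im z)).

Definition arc_length (J : set R[i]) : \bar R :=
  lebesgue_measure [set t : R | 0 <= t < 2 * pi /\ J (expC (t *i))].

Definition complementary_arcs (E : set R[i]) : set (set R[i]) :=
  connected_component (unit_circle `\` E) @` (unit_circle `\` E).

Definition integralC d (T : measurableType d) (mu : {measure set T -> \bar R})
    (D : set T) (f : T -> R[i]) : R[i] :=
  (\int[mu]_(x in D) complex.Re (f x)) +i* (\int[mu]_(x in D) complex.Im (f x)).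

(* A measure on the circle is represented by a Borel measure on the plane;
   the formula is meaningful for z in [unit_disk] only. *)
Definition singular_inner (mu : {measure set R[i] -> \bar R}) (z : R[i]) :
    R[i] :=
  expC (- integralC mu unit_circle (fun zeta => (zeta + z) / (zeta - z))).

Definition hardy (p : R) (f : R[i] -> R[i]) : Prop :=
  (forall z, unit_disk z -> derivable f z 1) /\
  (ereal_sup
     [set (((2 * pi)^-1)%:E *
           \int[lebesgue_measure]_(t in `[0%R, (2 * pi)%R])
             ((Normc.normc (f (r%:C * expC (t *i)))) `^ p)%:E)%E
     | r in [set r : R | (0 <= r < 1)%R]] < +oo)%E.

End Disk.

(* Main.v *)
Require Import Defs.
From HB Require Import structures.
From mathcomp Require Import all_boot all_order all_algebra.
From mathcomp Require Import all_classical all_reals all_analysis.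
From mathcomp Require Import complex measurable_realfun.
From mathcomp Require Import ring lra.
Import Order.TTheory GRing.Theory Num.Theory numFieldNormedType.Exports.
Local Open Scope classical_set_scope.
Local Open Scope ring_scope.
Set Implicit Arguments.
Unset Strict Implicit.
Unset Printing Implicit Defensive.

(** Up to a constant, [|S_mu'(z)|] is at most [u(z) = int |a - z|^-2 dmu(a)],
    because [S_mu' = - S_mu * int 2 a (a - z)^-2 dmu(a)] and [|S_mu| <= 1]
    (Lemma [normc_derive1_singular_inner]).  It remains to bound the integral
    of [u(r e^(it))^p] over a period, uniformly in [r].

    Let [t] belong to a complementary interval [(x, y)] of the set of angles of
    [E], and let [m] be the smaller of [t - x] and [y - t].  Every [a] in [E]
    is at distance at least [m / 2] from [e^(it)], and at distance at least
    [|a - e^(it)| / 2] from [r e^(it)].  Hence, for [0 < s < 1], [u(r e^(it))]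
    is at most a constant times [m^(s - 2) H(t)], where [H(t)] is the integral
    of [|a - e^(it)|^-s] with respect to [mu].  By Tonelli's theorem [H] is
    integrable over the circle, since [s < 1].

    If [b] is such that [(2 - s) p = b (1 - p)], the [p]-th power of
    [m^(s - 2) H] is the geometric mean [(m^-b)^(1 - p) H^p], at most
    [m^-b + H].  For [b < 1] the integral of [m^-b] over [(x, y)] is at most a
    constant times [(y - x)^(1 - b)], and for [b <= q] the sum of these powers
    is controlled by the hypothesis on the complementary arcs
    (Lemma [gaps_summable]).  Exponents [b] and [s] with all these properties
    exist because [p / (1 - p)] is smaller than both [q] and [1]
    (Lemma [exponent_choice]).

    Two points require care.  The Hardy class contains only functions that are
    complex differentiable, so [S_mu] has to be differentiated twice under the
    integral sign.  And the complementary arcs, which are connected components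
    in the plane, have to be matched with real intervals of angles: distinct
    intervals starting at a positive angle lie in distinct arcs, because a
    chord joining two points of [E] disconnects the circle
    (Lemma [chord_separates]). *)

(** * Derivatives over a numeric field *)

(** The normed module is [K] itself.  At [K = R[i]] this is the complex
    derivative, the bounds [e] and [d] of the lemmas below being then positive
    real elements of [R[i]]. *)
Definition is_cderiv (K : numFieldType) (f : K -> K) (x a : K) :=
  is_derive x 1 f a.

(** The difference quotient is cleared of its denominator: the remainders of
    integrals are estimated in this form. *)
Lemma is_cderivP (K : numFieldType) (f : K -> K) (x l : K) :
  (forall e : K, 0 < e -> exists2 d : K, 0 < d &
     forall h : K, `|h| < d -> `|f (h + x) - f x - l * h| <= e * `|h|) ->
  is_cderiv f x l.
Proof.
move=> H.
have L : (fun h => h^-1 *: (f (h *: 1 + x) - f x)) @ 0^' --> l.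
  apply/cvgrPdist_le => e e0; have [d d0 Hd] := H e e0.
  near=> h.
  have h0 : h != 0 by near: h; exact: nbhs_dnbhs_neq.
  have hd : `|h| < d.
    by near: h; exact: dnbhs0_lt.
  have := Hd h hd; rewrite -(ler_pM2l (x := `|h|^-1)) ?invr_gt0 ?normr_gt0//.
  rewrite mulrCA mulVf ?normr_eq0// mulr1 -normfV -normrM; apply: le_trans.
  rewrite -normrN opprB mulrBr [h^-1 * (l * h)]mulrCA mulVf// mulr1.
  by rewrite [h *: 1]mulr1.
apply: DeriveDef; last exact: cvg_lim.
by apply/cvg_ex; exists l.
Unshelve. all: by end_near. Qed.

Lemma is_cderiv_comp (K : numFieldType) (f g : K -> K) (x a b : K) :
  is_cderiv f x a -> is_cderiv g (f x) b -> is_cderiv (g \o f) x (b * a).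
Proof.
move=> [df fa] [dg gb].
move/derivable1_diffP : (df) => df'; move/derivable1_diffP : (dg) => dg'.
have H : differentiable (g \o f) x by exact: differentiable_comp.
apply: DeriveDef; first exact/derivable1_diffP.
rewrite -derive1E derive1E' // diff_comp //= deriv1E // deriv1E //=.
by rewrite !derive1E fa gb scale1r mulrC.
Qed.

Lemma is_cderivM (K : numFieldType) (f g : K -> K) (x a b : K) :
  is_cderiv f x a -> is_cderiv g x b ->
  is_cderiv (fun z => f z * g z) x (a * g x + f x * b).
Proof.
move=> df dg; have -> : a * g x + f x * b = f x *: b + g x *: a.
  by rewrite addrC [g x *: a]mulrC.
exact: (@is_deriveM K K^o f g x 1 a b df dg).
Qed.

Lemma is_cderivN (K : numFieldType) (f : K -> K) (x a : K) :
  is_cderiv f x a -> is_cderiv (fun z => - f z) x (- a).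
Proof. by move=> df; exact: is_deriveN. Qed.

Lemma is_cderiv_continuous (K : numFieldType) (f : K -> K) (x a : K) :
  is_cderiv f x a -> {for x, continuous f}.
Proof.
by move=> [/derivable1_diffP df _]; exact: differentiable_continuous.
Qed.

Lemma is_cderiv_near (K : numFieldType) (f g : K -> K) (x a d : K) :
  0 < d -> (forall y, `|y - x| < d -> f y = g y) ->
  is_cderiv f x a -> is_cderiv g x a.
Proof.
move=> d0 fg; apply: near_eq_is_derive.
near=> y; apply: fg; rewrite distrC; near: y.
exact: (@cvgr_dist_lt K K^o _ (nbhs x) _ id x (@cvg_id _ (nbhs x)) d d0).
Unshelve. all: by end_near. Qed.

Lemma is_cderiv_small (K : numFieldType) (f : K -> K) (x l e : K) :
  is_cderiv f x l -> 0 < e -> exists2 d : K, 0 < d &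
     forall h : K, `|h| < d -> `|f (h + x) - f x - l * h| <= e * `|h|.
Proof.
move=> [df fl] e0.
have L : (fun h => h^-1 *: (f (h *: 1 + x) - f x)) @ 0^' --> l.
  by rewrite -fl; exact: df.
have /cvgrPdist_le/(_ e e0)[/= d d0 Hd] := L.
exists d => // h hd; have [->|h0] := eqVneq h 0.
  by rewrite add0r subrr mulr0 subr0 normr0 mulr0.
have := Hd h; rewrite /= sub0r normrN => /(_ hd h0).
rewrite -(ler_pM2r (x := `|h|)) ?normr_gt0// -normrM; apply: le_trans.
by rewrite -normrN mulrBl opprB mulrAC mulVf// mul1r [h *: 1]mulr1.
Qed.

(** * The norm and the exponential of complex numbers *)

Section complex_norm.
Variable R : realType.
Implicit Types x y z : R[i].
Local Notation normc := Normc.normc.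
Local Open Scope complex_scope.

Lemma normc_ge0 z : 0 <= normc z.
Proof. by case: z => a b; exact: sqrtr_ge0. Qed.

Lemma ler_normcD x y : normc (x + y) <= normc x + normc y.
Proof. by have := ler_normD x y; rewrite -rmorphD lecR. Qed.

Lemma Re_le_normc z : `|complex.Re z| <= normc z.
Proof.
case: z => a b /=; rewrite -sqrtr_sqr ler_wsqrtr// lerDl sqr_ge0//.
Qed.

Lemma Im_le_normc z : `|complex.Im z| <= normc z.
Proof.
case: z => a b /=; rewrite -sqrtr_sqr ler_wsqrtr// lerDr sqr_ge0//.
Qed.

Lemma normc_le_ReIm z : normc z <= `|complex.Re z| + `|complex.Im z|.
Proof.
case: z => a b /=; rewrite -(ler_pXn2r (n := 2)) ?nnegrE ?sqrtr_ge0 ?addr_ge0//.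
rewrite sqr_sqrtr ?addr_ge0 ?sqr_ge0// sqrrD !real_normK ?num_real//.
by rewrite lerD2r lerDl mulrn_wge0// mulr_ge0.
Qed.

Lemma normc_sqr z : normc z ^+ 2 = complex.Re z ^+ 2 + complex.Im z ^+ 2.
Proof. by case: z => a b /=; rewrite sqr_sqrtr// addr_ge0 ?sqr_ge0. Qed.

Lemma normc_real (a : R) : normc a%:C = `|a|.
Proof. by rewrite /= expr0n/= addr0 sqrtr_sqr. Qed.

Lemma normc_eq0 z : (normc z == 0) = (z == 0).
Proof.
by apply/eqP/eqP => [|->]; [exact: Normc.eq0_normc | exact: Normc.normc0].
Qed.

Lemma gt0_complexP (e : R[i]) : 0 < e -> exists2 r : R, 0 < r & e = r%:C.
Proof.
by case: e => a b; rewrite ltcE /= => /andP[/eqP-> a0]; exists a.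
Qed.

Lemma is_cderiv_normcP (f : R[i] -> R[i]) x (l : R[i]) :
  (forall e : R, 0 < e -> exists2 d, 0 < d & forall h : R[i], normc h < d ->
     normc (f (h + x) - f x - l * h) <= e * normc h) ->
  @is_cderiv R[i] f x l.
Proof.
move=> H; apply: is_cderivP => e /gt0_complexP[r r0 ->].
have [d d0 Hd] := H r r0; exists d%:C; first by rewrite ltcR.
by move=> h; rewrite /Num.norm/= ltcR -rmorphM lecR; exact: Hd.
Qed.

Lemma expCD x y : expC (x + y) = expC x * expC y.
Proof.
case: x y => [a b] [c d]; rewrite /expC/= expRD cosD sinD.
by apply/eqP; rewrite eq_complex /=; apply/andP; split; apply/eqP; ring.
Qed.

Lemma normc_expC z : normc (expC z) = expR (complex.Re z).
Proof.
rewrite /expC /= !exprMn -mulrDr cos2Dsin2 mulr1 sqrtr_sqr.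
by rewrite ger0_norm// expR_ge0.
Qed.

(** With [h = x + iy], both coordinates of the remainder are combinations of
    the first order remainders of [expR], [cos] and [sin] at 0 and of the
    product [x * y]. *)
Lemma expC_sub1_small (e : R) : 0 < e -> exists2 d, 0 < d &
  forall h : R[i], normc h < d -> normc (expC h - 1 - h) <= e * normc h.
Proof.
(* The coordinates contribute [2 * e' * |x| + 5 * e' * |y|] in all. *)
move=> e0; pose e' := e / 7; have e'0 : 0 < e' by rewrite divr_gt0.
have [d1 d10 H1] := is_cderiv_small (is_derive_expR (0 : R)) e'0.
have [d2 d20 H2] := is_cderiv_small (is_derive_cos (0 : R)) e'0.
have [d3 d30 H3] := is_cderiv_small (is_derive_sin (0 : R)) e'0.
exists (Num.min 1 (Num.min e' (Num.min d1 (Num.min d2 d3)))).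
  by rewrite !lt_min ltr01 e'0 d10 d20.
move=> h; rewrite !lt_min => /and5P[h1 he hd1 hd2 hd3].
have hx := Re_le_normc h; have hy := Im_le_normc h.
have := H1 (complex.Re h) (le_lt_trans hx hd1).
have := H2 (complex.Im h) (le_lt_trans hy hd2).
have := H3 (complex.Im h) (le_lt_trans hy hd3).
rewrite !addr0 expR0 cos0 sin0 !oppr0 !addr0 mul0r !mul1r !subr0.
set x := complex.Re h in hx *; set y := complex.Im h in hy *.
move=> Hsin Hcos Hexp.
apply: (le_trans (normc_le_ReIm _)).
have -> : complex.Re (expC h - 1 - h) =
    (expR x - 1 - x) * cos y + (1 + x) * (cos y - 1).
  by rewrite /expC/x/y; case: (h) => a b /=; ring.
have -> : complex.Im (expC h - 1 - h) =
    (expR x - 1 - x) * sin y + (1 + x) * (sin y - y) + x * y.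
  by rewrite /expC/x/y; case: (h) => a b /=; ring.
have nx0 := normr_ge0 x; have ny0 := normr_ge0 y.
have n1x : `|1 + x| <= 2.
  by rewrite (le_trans (ler_normD _ _))// normr1; lra.
have c1 : `|cos y| <= 1 by rewrite ler_norml cos_geN1 cos_le1.
have s1 : `|sin y| <= 1 by rewrite ler_norml sin_geN1 sin_le1.
have A1 : `|(expR x - 1 - x) * cos y| <= e' * `|x|.
  by rewrite normrM -[leRHS]mulr1 ler_pM.
have A2 : `|(expR x - 1 - x) * sin y| <= e' * `|x|.
  by rewrite normrM -[leRHS]mulr1 ler_pM.
have A3 : `|(1 + x) * (cos y - 1)| <= 2 * (e' * `|y|) by rewrite normrM ler_pM.
have A4 : `|(1 + x) * (sin y - y)| <= 2 * (e' * `|y|) by rewrite normrM ler_pM.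
have A5 : `|x * y| <= e' * `|y|.
  by rewrite normrM ler_wpM2r// (le_trans hx (ltW he)).
have B1 := ler_normD ((expR x - 1 - x) * cos y) ((1 + x) * (cos y - 1)).
have B2 := ler_normD ((expR x - 1 - x) * sin y + (1 + x) * (sin y - y)) (x * y).
have B3 := ler_normD ((expR x - 1 - x) * sin y) ((1 + x) * (sin y - y)).
have C1 : e' * `|x| <= e' * normc h by rewrite ler_wpM2l// ltW.
have C2 : e' * `|y| <= e' * normc h by rewrite ler_wpM2l// ltW.
have -> : e * normc h = 7 * (e' * normc h) by rewrite /e'; field.
lra.
Qed.

Lemma is_cderiv_expC z : @is_cderiv R[i] (@expC R) z (expC z).
Proof.
apply: is_cderiv_normcP => e e0.
pose k := normc (expC z).
have k0 : 0 < k by rewrite /k normc_expC expR_gt0.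
have [d d0 Hd] := expC_sub1_small (divr_gt0 e0 k0).
exists d => // h hd; rewrite expCD.
have -> : expC h * expC z - expC z - expC z * h = expC z * (expC h - 1 - h).
  by ring.
rewrite Normc.normcM -/k (le_trans (ler_wpM2l (ltW k0) (Hd h hd)))//.
by rewrite mulrA mulrCA mulfV ?gt_eqF// mulr1.
Qed.

End complex_norm.

(** * Continuity and Borel measurability in the plane *)

Lemma continuous_at_dist (K : numFieldType) (R : realType) (f : K -> R) x :
  (forall e : R, 0 < e -> exists2 d : K, 0 < d &
    forall y, `|x - y| < d -> `|f x - f y| < e) -> {for x, continuous f}.
Proof.
move=> H; apply/(@cvgrPdist_lt R R^o K (nbhs x) (nbhs_filter x)) => e e0.
have [d d0 Hd] := H e e0.
by exists d.
Qed.

Section complex_continuity.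
Variable R : realType.
Local Notation normc := Normc.normc.
Local Open Scope complex_scope.

Lemma normcBC (x y : R[i]) : normc (x - y) = normc (y - x).
Proof. by rewrite -normcN opprB. Qed.

Lemma normc_lipschitz (x y : R[i]) : `|normc x - normc y| <= normc (x - y).
Proof.
have H (u v : R[i]) : normc u - normc v <= normc (u - v).
  by rewrite lerBlDr (le_trans _ (ler_normcD _ _))// subrK.
by rewrite ler_norml H lerNl opprB normcBC H.
Qed.

Lemma continuous_lipschitzC (f : R[i] -> R) :
  (forall x y, `|f x - f y| <= normc (x - y)) -> continuous f.
Proof.
move=> lf x; apply: (@continuous_at_dist R[i] R) => e e0.
exists e%:C; first by rewrite ltcR.
by move=> y; rewrite [X in X < _]/(normc _)%:C ltcR; exact: le_lt_trans.
Qed.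

Lemma continuous_normc : continuous (@normc R).
Proof. exact/continuous_lipschitzC/normc_lipschitz. Qed.

Lemma continuous_Re : continuous (@complex.Re R).
Proof.
apply: continuous_lipschitzC => x y; apply: le_trans (Re_le_normc _).
by case: x y => [a b] [c d].
Qed.

Lemma continuous_Im : continuous (@complex.Im R).
Proof.
apply: continuous_lipschitzC => x y; apply: le_trans (Im_le_normc _).
by case: x y => [a b] [c d].
Qed.

Lemma continuous_ReIm (f g : R -> R) : continuous f -> continuous g ->
  continuous (fun t => f t +i* g t : R[i]).
Proof.
move=> cf cg t; apply/(@cvgrPdist_lt R[i] R[i]^o) => e /gt0_complexP[r r0 ->].
have r2 : 0 < r / 2 by rewrite divr_gt0.
have /cvgrPdist_lt/(_ _ r2) Hf := cf t; have /cvgrPdist_lt/(_ _ r2) Hg := cg t.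
near=> s; rewrite [X in X < _]/(normc _)%:C ltcR.
apply: (le_lt_trans (normc_le_ReIm _)) => /=.
by rewrite [r]splitr ltrD//; near: s.
Unshelve. all: by end_near. Qed.

Lemma continuous_measurableC (f : R[i] -> R) :
  continuous f -> measurable_fun setT f.
Proof.
move=> /continuousP cf.
apply: (measurability _ (measurable_realfun.RGenOpens.measurableE R)).
move=> _ [_ [a [b ->] <-]]; rewrite setTI; apply: sub_sigma_algebra.
exact/cf/interval_open.
Qed.

Lemma closed_measurableC (A : set R[i]) : closed A -> measurable A.
Proof.
move=> cA; rewrite -(setCK A); apply: measurableC; apply: sub_sigma_algebra.
exact: closed_openC.
Qed.

Lemma unit_circleE : @unit_circle R = [set z | normc z = 1].
Proof.
by apply/seteqP; split => z /=; rewrite /unit_circle/=; 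
  [move=> [] | move=> H; rewrite [LHS]/(normc _)%:C H].
Qed.

Lemma unit_diskE : @unit_disk R = [set z | normc z < 1].
Proof. by apply/seteqP; split => z /=; rewrite /unit_disk/= -ltcR. Qed.

Lemma measurable_unit_circle : measurable (@unit_circle R).
Proof.
rewrite unit_circleE (_ : [set z | _] = setT `&` (@normc R) @^-1` [set 1]).
  exact: continuous_measurableC continuous_normc _ _ _.
by rewrite setTI.
Qed.
End complex_continuity.

(** * Integrals of complex functions *)

Definition cmeasurable d (T : measurableType d) (R : realType)
    (f : T -> R[i]) :=
  measurable_fun setT (@complex.Re R \o f) /\
  measurable_fun setT (@complex.Im R \o f).

Section cmeasurable.
Context d (T : measurableType d) (R : realType).
Implicit Types f g : T -> R[i].
Local Notation normc := (@Normc.normc R).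

(** The inverse of a nonnegative number is its real power of exponent -1,
    which covers the value at 0 too. *)
Lemma measurable_funV (f : T -> R) : (forall x, 0 <= f x) ->
  measurable_fun setT f -> measurable_fun setT (fun x => (f x)^-1).
Proof.
move=> f0 mf; rewrite (_ : (fun x => _) = (@powR R ^~ (-1)) \o f).
  by apply: measurableT_comp mf; exact: measurable_powR.
by apply/funext => x /=; rewrite powR_inv1.
Qed.

Lemma cmeasurable_cst (a : R[i]) : cmeasurable (fun _ : T => a).
Proof. by split; exact: measurable_cst. Qed.

Lemma cmeasurableD f g :
  cmeasurable f -> cmeasurable g -> cmeasurable (fun x => f x + g x).
Proof.
move=> [f1 f2] [g1 g2]; split.
- rewrite (_ : _ \o _ = (@complex.Re R \o f) \+ (@complex.Re R \o g)).
    exact: measurable_funD.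
  by apply/funext => x /=; case: (f x) (g x) => [? ?] [? ?].
- rewrite (_ : _ \o _ = (@complex.Im R \o f) \+ (@complex.Im R \o g)).
    exact: measurable_funD.
  by apply/funext => x /=; case: (f x) (g x) => [? ?] [? ?].
Qed.

Lemma cmeasurableM f g :
  cmeasurable f -> cmeasurable g -> cmeasurable (fun x => f x * g x).
Proof.
move=> [f1 f2] [g1 g2]; split.
- rewrite (_ : _ \o _ = ((@complex.Re R \o f) \* (@complex.Re R \o g)) \-
                        ((@complex.Im R \o f) \* (@complex.Im R \o g))).
    by apply: measurable_funB; exact: measurable_funM.
  by apply/funext => x /=; case: (f x) (g x) => [? ?] [? ?].
- rewrite (_ : _ \o _ = ((@complex.Re R \o f) \* (@complex.Im R \o g)) \+
                        ((@complex.Im R \o f) \* (@complex.Re R \o g))).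
    by apply: measurable_funD; exact: measurable_funM.
  by apply/funext => x /=; case: (f x) (g x) => [? ?] [? ?].
Qed.

Lemma cmeasurableX f n : cmeasurable f -> cmeasurable (fun x => f x ^+ n).
Proof.
move=> mf; elim: n => [|n IH]; first exact: cmeasurable_cst.
rewrite (_ : (fun x => _) = (fun x => f x * f x ^+ n)).
  exact: cmeasurableM.
by apply/funext => x; rewrite exprS.
Qed.

Lemma cmeasurableV f : cmeasurable f -> cmeasurable (fun x => (f x)^-1).
Proof.
move=> [f1 f2].
pose n2 x := ((@complex.Re R \o f) x ^+ 2 + (@complex.Im R \o f) x ^+ 2)^-1.
have mn2 : measurable_fun setT n2.
  apply: measurable_funV => [x|]; first by rewrite addr_ge0 ?sqr_ge0.
  by apply: measurable_funD; exact: measurable_funX.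
split.
- rewrite (_ : _ \o _ = (@complex.Re R \o f) \* n2).
    exact: measurable_funM.
  by apply/funext => x; rewrite /n2 /=; case: (f x).
- rewrite (_ : _ \o _ = \- ((@complex.Im R \o f) \* n2)).
    by apply: measurable_funN; exact: measurable_funM.
  by apply/funext => x; rewrite /n2 /=; case: (f x).
Qed.

Lemma cmeasurable_normc f : cmeasurable f -> measurable_fun setT (normc \o f).
Proof.
move=> [f1 f2]; rewrite (_ : _ \o _ =
  @powR R ^~ 2^-1 \o
    (fun x => (@complex.Re R \o f) x ^+ 2 + (@complex.Im R \o f) x ^+ 2)).
  apply: measurableT_comp; first exact: measurable_powR.
  by apply: measurable_funD; exact: measurable_funX.
apply/funext => x /=; rewrite powR12_sqrt ?addr_ge0 ?sqr_ge0//.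
by case: (f x).
Qed.
End cmeasurable.

Lemma cmeasurable_id (R : realType) : cmeasurable (fun z : R[i] => z).
Proof.
by split; apply: continuous_measurableC;
  [exact: continuous_Re | exact: continuous_Im].
Qed.

Section integralC_theory.
Context d (T : measurableType d) (R : realType).
Variables (mu : {finite_measure set T -> \bar R}) (D : set T).
Hypothesis mD : measurable D.
Implicit Types f g : T -> R[i].
Local Notation normc := (@Normc.normc R).
Local Open Scope complex_scope.

Definition bounded_cfun f :=
  cmeasurable f /\ exists M : R, forall x, D x -> normc (f x) <= M.

Lemma bounded_integrable (h : T -> R) (M : R) : measurable_fun setT h ->
  (forall x, D x -> `|h x| <= M) -> mu.-integrable D (EFin \o h).
Proof.
move=> mh hM; apply: (le_integrable _ _ _ (g := EFin \o cst M)) => //.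
- by apply/measurable_EFinP; exact: measurable_funTS.
- move=> x Dx /=; rewrite lee_fin (le_trans (hM _ Dx))// ler_norm//.
- exact: finite_measure_integrable_cst.
Qed.

Lemma integrable_Re f : bounded_cfun f ->
  mu.-integrable D (EFin \o (@complex.Re R \o f)).
Proof.
move=> [[mf _] [M fM]]; apply: (@bounded_integrable _ M) => // x Dx.
exact: le_trans (Re_le_normc _) (fM x Dx).
Qed.

Lemma integrable_Im f : bounded_cfun f ->
  mu.-integrable D (EFin \o (@complex.Im R \o f)).
Proof.
move=> [[_ mf] [M fM]]; apply: (@bounded_integrable _ M) => // x Dx.
exact: le_trans (Im_le_normc _) (fM x Dx).
Qed.

Lemma integrable_normc f : bounded_cfun f ->
  mu.-integrable D (EFin \o (normc \o f)).
Proof.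
move=> [mf [M fM]]; apply: (@bounded_integrable _ M) => [|x Dx].
  exact: cmeasurable_normc.
by rewrite ger0_norm ?normc_ge0//; exact: fM.
Qed.

Lemma bounded_cfunD f g : bounded_cfun f -> bounded_cfun g ->
  bounded_cfun (fun x => f x + g x).
Proof.
move=> [mf [M fM]] [mg [N gN]]; split; first exact: cmeasurableD.
exists (M + N) => x Dx; rewrite (le_trans (ler_normcD _ _))// lerD ?fM ?gN//.
Qed.

Lemma bounded_cfunMr f (c : R[i]) : bounded_cfun f ->
  bounded_cfun (fun x => f x * c).
Proof.
move=> [mf [M fM]]; split; first exact/cmeasurableM/cmeasurable_cst.
exists (M * normc c) => x Dx; rewrite Normc.normcM ler_wpM2r ?fM ?normc_ge0//.
Qed.

Lemma integralCD f g : bounded_cfun f -> bounded_cfun g ->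
  integralC mu D (fun x => f x + g x) = integralC mu D f + integralC mu D g.
Proof.
move=> nf ng; rewrite /integralC.
apply/eqP; rewrite eq_complex /=; apply/andP; split; apply/eqP.
- rewrite -RintegralD//; [|exact: integrable_Re|exact: integrable_Re].
  by apply: eq_Rintegral => x _; case: (f x) (g x) => [? ?] [? ?].
- rewrite -RintegralD//; [|exact: integrable_Im|exact: integrable_Im].
  by apply: eq_Rintegral => x _; case: (f x) (g x) => [? ?] [? ?].
Qed.

Lemma integralCMr f c : bounded_cfun f ->
  integralC mu D (fun x => f x * c) = integralC mu D f * c.
Proof.
move=> nf; rewrite /integralC; case: c => a b.
have iR := integrable_Re nf; have iI := integrable_Im nf.
have sc (k : R) h : mu.-integrable D (EFin \o h) ->
    mu.-integrable D (EFin \o (fun x => k * h x)).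
  by move=> ih; exact: (integrableZl mD k ih).
apply/eqP; rewrite eq_complex /=; apply/andP; split; apply/eqP.
- rewrite ![_ * a]mulrC ![_ * b]mulrC -!RintegralZl// -RintegralB//.
  + by apply: eq_Rintegral => x _; case: (f x) => ? ? /=; ring.
  + exact: sc.
  + exact: sc.
- rewrite ![_ * a]mulrC ![_ * b]mulrC -!RintegralZl// -RintegralD//.
  + by apply: eq_Rintegral => x _; case: (f x) => ? ? /=; ring.
  + exact: sc.
  + exact: sc.
Qed.

(** The real and imaginary parts are estimated separately; hence the factor
    2. *)
Lemma le_normc_integralC f : bounded_cfun f ->
  normc (integralC mu D f) <= 2 * \int[mu]_(x in D) normc (f x).
Proof.
move=> nf; rewrite (le_trans (normc_le_ReIm _))//= mulr_natl mulr2n lerD//.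
- apply: le_trans (le_normr_Rintegral mD (integrable_Re nf)) _.
  apply: le_Rintegral => //; last by move=> x _; exact: Re_le_normc.
  + exact: integrable_norm (integrable_Re nf).
  + exact: integrable_normc.
- apply: le_trans (le_normr_Rintegral mD (integrable_Im nf)) _.
  apply: le_Rintegral => //; last by move=> x _; exact: Im_le_normc.
  + exact: integrable_norm (integrable_Im nf).
  + exact: integrable_normc.
Qed.

Lemma le_normc_integralC_cst f (M : R) : bounded_cfun f ->
  (forall x, D x -> normc (f x) <= M) ->
  normc (integralC mu D f) <= 2 * (M * fine (mu D)).
Proof.
move=> nf fM; rewrite (le_trans (le_normc_integralC nf))// ler_wpM2l//.
rewrite -Rintegral_cst//; apply: le_Rintegral => //.
  exact: integrable_normc.
exact: finite_measure_integrable_cst.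
Qed.

(** Differentiation under the integral sign.  The remainder of the kernel is
    of second order in [h], uniformly on [D], so the remainder of the integral
    is at most [2 M mu(D) |h|^2]. *)
Lemma is_cderiv_integralC (k : T -> R[i] -> R[i]) (k1 : T -> R[i]) z (r M : R) :
  0 < r -> (forall h : R[i], normc h < r -> bounded_cfun (k ^~ (h + z))) ->
  bounded_cfun k1 ->
  (forall x h, D x -> normc h < r ->
     normc (k x (h + z) - k x z - k1 x * h) <= M * normc h ^+ 2) ->
  @is_cderiv R[i] (fun w => integralC mu D (k ^~ w)) z (integralC mu D k1).
Proof.
move=> r0 nk nk1 kM; apply: is_cderiv_normcP => e e0.
have nkz : bounded_cfun (k ^~ z).
  by rewrite -[z]add0r; apply: nk; rewrite Normc.normc0.
(* The summand 1 keeps [B] positive when [M] or [mu D] vanishes. *)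
pose B := 2 * (`|M| * fine (mu D)) + 1.
have m0 : 0 <= fine (mu D) by rewrite fine_ge0.
have B0 : 0 < B by rewrite ltr_wpDl// mulr_ge0// mulr_ge0.
exists (Num.min r (e / B)); first by rewrite lt_min r0 divr_gt0.
move=> h; rewrite lt_min => /andP[hd he].
have E : integralC mu D (k ^~ (h + z)) - integralC mu D (k ^~ z) -
    integralC mu D k1 * h =
  integralC mu D (fun x => k x (h + z) + k x z * -1 + k1 x * - h).
  rewrite integralCD; last exact: bounded_cfunMr.
    rewrite integralCD; [|exact: nk|exact: bounded_cfunMr].
    by rewrite !integralCMr// mulrN1 mulrN.
  by apply: bounded_cfunD; [exact: nk|exact: bounded_cfunMr].
rewrite E (le_trans (le_normc_integralC_cst (M := `|M| * normc h ^+ 2) _ _))//.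
- apply: bounded_cfunD; last exact: bounded_cfunMr.
  by apply: bounded_cfunD; [exact: nk|exact: bounded_cfunMr].
- move=> x Dx; rewrite mulrN1 mulrN (le_trans (kM x h Dx hd))//.
  by rewrite ler_wpM2r ?sqr_ge0// ler_norm.
- have -> : 2 * (`|M| * normc h ^+ 2 * fine (mu D)) =
    2 * (`|M| * fine (mu D)) * normc h * normc h by ring.
  rewrite ler_wpM2r ?normc_ge0//.
  rewrite ltr_pdivlMr// in he; apply: le_trans (ltW he).
  rewrite mulrC ler_wpM2l ?normc_ge0//.
  by rewrite /B lerDl.
Qed.
End integralC_theory.

(** * The derivative of a singular inner function *)

(** Here and in the next lemma, the remainder of a first order expansion is
    written with its factor [h ^+ 2] in evidence. *)
Lemma herglotz_expand1 (K : fieldType) (a z h : K) : a - z != 0 ->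
  a - (h + z) != 0 ->
  (a + (h + z)) / (a - (h + z)) - (a + z) / (a - z) -
    2 * a * (a - z)^-1 ^+ 2 * h =
  2 * a * h ^+ 2 * (a - (h + z))^-1 * (a - z)^-1 ^+ 2.
Proof. by move=> az azh; field; rewrite az azh. Qed.

Lemma herglotz_expand2 (K : fieldType) (a z h : K) : a - z != 0 ->
  a - (h + z) != 0 ->
  2 * a * (a - (h + z))^-1 ^+ 2 - 2 * a * (a - z)^-1 ^+ 2 -
    4 * a * (a - z)^-1 ^+ 3 * h =
  2 * a * h ^+ 2 * (a - z)^-1 ^+ 2 * (a - (h + z))^-1 *
   ((a - (h + z))^-1 + 2 * (a - z)^-1).
Proof. by move=> az azh; field; rewrite az azh. Qed.

Section singular_inner_derivative.
Variable R : realType.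
Variable mu : {finite_measure set R[i] -> \bar R}.
Local Notation normc := (@Normc.normc R).
Local Notation circle := (@unit_circle R).
Local Open Scope complex_scope.
Implicit Types z h a : R[i].

Let measurable_circle : measurable circle := @measurable_unit_circle R.

Definition herglotz z := integralC mu circle (fun a => (a + z) / (a - z)).
Definition herglotz_deriv z :=
  integralC mu circle (fun a => 2 * a * (a - z)^-1 ^+ 2).

Let cmeasurableB z : cmeasurable (fun a : R[i] => a - z).
Proof. exact/cmeasurableD/cmeasurable_cst/cmeasurable_id. Qed.

Let cmeasurableBV z n : cmeasurable (fun a : R[i] => (a - z)^-1 ^+ n).
Proof. exact/cmeasurableX/cmeasurableV/cmeasurableB. Qed.

Lemma circle_dist a z : circle a -> 1 - normc z <= normc (a - z).
Proof.
by rewrite unit_circleE /= => <-; apply: le_trans (normc_lipschitz _ _);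
  exact: ler_norm.
Qed.

Lemma normc_inv_le a z (r : R) : 0 < r -> r <= 1 - normc z -> circle a ->
  normc (a - z)^-1 <= r^-1.
Proof.
move=> r0 rz ca; rewrite Normc.normcV.
have rh : r <= normc (a - z) by rewrite (le_trans rz)// circle_dist.
by rewrite lef_pV2// posrE (lt_le_trans r0).
Qed.

Lemma normc_nat n : normc n%:R = n%:R :> R.
Proof. by rewrite normcMn Normc.normc1. Qed.

Lemma normcX a n : normc (a ^+ n) = normc a ^+ n.
Proof.
elim: n => [|n IH]; first by rewrite !expr0 Normc.normc1.
by rewrite !exprS Normc.normcM IH.
Qed.

Lemma circle_sub_neq0 a z : circle a -> normc z < 1 -> a - z != 0.
Proof.
move=> ca z1; rewrite -normc_eq0 gt_eqF// (lt_le_trans _ (circle_dist z ca))//.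
by rewrite subr_gt0.
Qed.

Let bounded_cauchy_pow z n (c : R[i]) : normc z < 1 ->
  bounded_cfun circle (fun a => c * a * (a - z)^-1 ^+ n).
Proof.
move=> z1; split.
  by apply: cmeasurableM => //; apply: cmeasurableM;
    [exact: cmeasurable_cst|exact: cmeasurable_id].
exists (normc c * (1 - normc z)^-1 ^+ n) => a ca.
have z1' : 0 < 1 - normc z by rewrite subr_gt0.
have a1 : normc a = 1 by move: ca; rewrite unit_circleE.
rewrite !Normc.normcM a1 mulr1 ler_wpM2l ?normc_ge0// normcX.
rewrite lerXn2r// ?nnegrE ?normc_ge0 ?invr_ge0 ?(ltW z1')//.
exact: normc_inv_le.
Qed.

Let bounded_herglotz_kernel z : normc z < 1 ->
  bounded_cfun circle (fun a => (a + z) / (a - z)).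
Proof.
move=> z1; split.
  apply: cmeasurableM; last exact/cmeasurableV/cmeasurableB.
  by apply: cmeasurableD; [exact: cmeasurable_id|exact: cmeasurable_cst].
exists (2 * (1 - normc z)^-1) => a ca.
have z1' : 0 < 1 - normc z by rewrite subr_gt0.
have a1 : normc a = 1 by move: ca; rewrite unit_circleE.
rewrite Normc.normcM ler_pM ?normc_ge0//; last exact: normc_inv_le.
by rewrite (le_trans (ler_normcD _ _))// a1; lra.
Qed.

(** Within half the distance of [z] to the circle, all the denominators that
    occur are at least [r]. *)
Let radius_bounds z (r := (1 - normc z) / 2) h a : normc z < 1 -> normc h < r ->
  circle a ->
  [/\ 0 < r, normc (h + z) < 1, normc (a - z)^-1 <= r^-1 &
      normc (a - (h + z))^-1 <= r^-1].
Proof.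
move=> z1 hr ca; have r0 : 0 < r by rewrite divr_gt0// subr_gt0.
have := ler_normcD h z => hz; rewrite /r in hr *.
by split=> //; [lra|apply: normc_inv_le => //; lra..].
Qed.

Lemma is_cderiv_herglotz z : normc z < 1 ->
  @is_cderiv R[i] herglotz z (herglotz_deriv z).
Proof.
move=> z1; pose r := (1 - normc z) / 2.
have r0 : 0 < r by rewrite divr_gt0// subr_gt0.
apply: (@is_cderiv_integralC _ _ _ mu circle measurable_circle
   (fun a z => (a + z) / (a - z)) _ z r (2 * r^-1 ^+ 3)) => //.
- move=> h hr; apply: bounded_herglotz_kernel.
  by have := ler_normcD h z; rewrite /r in hr; lra.
- exact: bounded_cauchy_pow.
- move=> a h ca hr; have [_ hz1 H1 H2] := radius_bounds z1 hr ca.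
  rewrite herglotz_expand1; [|exact: circle_sub_neq0..].
  have a1 : normc a = 1 by move: ca; rewrite unit_circleE.
  rewrite 4!Normc.normcM 2!normcX a1 mulr1 normc_nat.
  have -> : 2 * r^-1 ^+ 3 * normc h ^+ 2 =
    2 * normc h ^+ 2 * r^-1 * r^-1 ^+ 2 by ring.
  have ir0 : 0 <= r^-1 by rewrite invr_ge0 ltW.
  by rewrite !ler_pM ?mulr_ge0 ?exprn_ge0 ?normc_ge0// lerXn2r// ?nnegrE
    ?normc_ge0.
Qed.

Lemma is_cderiv_herglotz_deriv z : normc z < 1 ->
  exists l, @is_cderiv R[i] herglotz_deriv z l.
Proof.
move=> z1; pose r := (1 - normc z) / 2.
have r0 : 0 < r by rewrite divr_gt0// subr_gt0.
exists (integralC mu circle (fun a => 4 * a * (a - z)^-1 ^+ 3)).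
apply: (@is_cderiv_integralC _ _ _ mu circle measurable_circle
   (fun a z => 2 * a * (a - z)^-1 ^+ 2) _ z r (6 * r^-1 ^+ 4)) => //.
- move=> h hr; apply: bounded_cauchy_pow.
  by have := ler_normcD h z; rewrite /r in hr; lra.
- exact: bounded_cauchy_pow.
- move=> a h ca hr; have [_ hz1 H1 H2] := radius_bounds z1 hr ca.
  rewrite herglotz_expand2; [|exact: circle_sub_neq0..].
  have a1 : normc a = 1 by move: ca; rewrite unit_circleE.
  rewrite 5!Normc.normcM 2!normcX a1 mulr1 normc_nat.
  have -> : 6 * r^-1 ^+ 4 * normc h ^+ 2 =
    2 * normc h ^+ 2 * r^-1 ^+ 2 * r^-1 * (3 * r^-1) by ring.
  have ir0 : 0 <= r^-1 by rewrite invr_ge0 ltW.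
  have H3 : normc ((a - (h + z))^-1 + 2 * (a - z)^-1) <= 3 * r^-1.
    apply: le_trans (ler_normcD _ _) _; rewrite Normc.normcM normc_nat.
    move: H1 H2; set u := normc _; set v := normc _; set w := r^-1; lra.
  by rewrite !ler_pM ?mulr_ge0 ?exprn_ge0 ?normc_ge0// lerXn2r// ?nnegrE
    ?normc_ge0.
Qed.

Lemma is_cderiv_singular_inner z : normc z < 1 ->
  @is_cderiv R[i] (singular_inner mu) z
    (singular_inner mu z * - herglotz_deriv z).
Proof.
move=> z1; apply: (@is_cderiv_comp R[i] (fun z => - herglotz z) (@expC R)).
  exact/is_cderivN/is_cderiv_herglotz.
exact: is_cderiv_expC.
Qed.

Lemma derive1_singular_inner z : normc z < 1 ->
  derive1 (singular_inner mu) z = singular_inner mu z * - herglotz_deriv z.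
Proof. by move=> /is_cderiv_singular_inner[_ <-]; rewrite derive1E. Qed.

(** The product formula for the derivative holds in the disk only, so it is
    transported through a neighbourhood of [z] contained in the disk. *)
Lemma is_cderiv_derive1_singular_inner z : normc z < 1 ->
  exists l, @is_cderiv R[i] (derive1 (singular_inner mu)) z l.
Proof.
move=> z1; have [l dl] := is_cderiv_herglotz_deriv z1.
eexists; apply: (@is_cderiv_near R[i]
   (fun w => singular_inner mu w * - herglotz_deriv w) _ _ _ (1 - normc z)%:C).
- by rewrite ltcR subr_gt0.
- move=> w; rewrite [X in X < _]/(normc _)%:C ltcR => wz.
  apply/esym/derive1_singular_inner.
  rewrite -[ltRHS](subrK (normc z)) -ltrBlDr; apply: le_lt_trans wz.
  exact: le_trans (ler_norm _) (normc_lipschitz _ _).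
- exact: (@is_cderivM R[i] _ _ z _ _ (is_cderiv_singular_inner z1)
    (@is_cderivN R[i] _ z l dl)).
Qed.

(** The real part of the Herglotz kernel is the Poisson kernel, which is
    nonnegative in the disk. *)
Lemma normc_singular_inner_le1 z : normc z < 1 ->
  normc (singular_inner mu z) <= 1.
Proof.
move=> z1; rewrite normc_expC -expR0 ler_expR/= oppr_le0.
apply: Rintegral_ge0 => a; rewrite unit_circleE /= => ca.
have /eqP := normc_sqr a; rewrite ca expr1n.
have : normc z ^+ 2 < 1 by rewrite expr_lt1 ?normc_ge0.
rewrite normc_sqr; case: (a) z {z1} => [x y] [u v] /= uv /eqP xy.
have D0 : 0 <= (x - u) ^+ 2 + (y - v) ^+ 2 by rewrite addr_ge0 ?sqr_ge0.
have -> : (x + u) * ((x - u) / ((x - u) ^+ 2 + (y - v) ^+ 2)) -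
          (y + v) * (- ((y - v) / ((x - u) ^+ 2 + (y - v) ^+ 2))) =
          (x ^+ 2 + y ^+ 2 - (u ^+ 2 + v ^+ 2)) / ((x - u) ^+ 2 + (y - v) ^+ 2).
  by rewrite mulrN opprK !mulrA -mulrDl; congr (_ / _); ring.
by rewrite divr_ge0// -xy subr_ge0 ltW.
Qed.

(** One factor 2 comes from the kernel [2 a (a - z)^-2], the other one from
    [le_normc_integralC]. *)
Lemma normc_derive1_singular_inner z : normc z < 1 ->
  normc (derive1 (singular_inner mu) z) <=
  4 * \int[mu]_(a in circle) (normc (a - z))^-1 ^+ 2.
Proof.
move=> z1; rewrite derive1_singular_inner// Normc.normcM normcN.
have H : normc (herglotz_deriv z) <=
    4 * \int[mu]_(a in circle) (normc (a - z))^-1 ^+ 2.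
  apply: le_trans (le_normc_integralC mu measurable_circle
    (bounded_cauchy_pow 2 2 z1)) _.
  rewrite (_ : 4 = 2 * 2 :> R) -?mulrA ?ler_wpM2l//; last by ring.
  rewrite -RintegralZl//; last first.
    have /(integrable_normc mu measurable_circle) := bounded_cauchy_pow 2 1 z1.
    apply: eq_integrable => // a; rewrite inE unit_circleE /= => ca.
    by rewrite mul1r Normc.normcM ca mul1r normcX Normc.normcV.
  rewrite le_eqVlt; apply/orP; left; apply/eqP; apply: eq_Rintegral => a.
  rewrite inE unit_circleE /= => ca.
  by rewrite 2!Normc.normcM ca mulr1 normc_nat normcX Normc.normcV.
rewrite -[leRHS]mul1r ler_pM ?normc_ge0// normc_singular_inner_le1//.
Qed.
End singular_inner_derivative.

(** * Geometry of the unit circle *)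

Section circle_geometry.
Variable R : realType.
Local Notation normc := (@Normc.normc R).
Local Open Scope complex_scope.
Implicit Types t s x : R.

Definition expi t : R[i] := expC (t *i).

Lemma expiE t : expi t = cos t +i* sin t.
Proof. by rewrite /expi /expC /= expR0 !mul1r. Qed.

Lemma normc_expi t : normc (expi t) = 1.
Proof. by rewrite normc_expC expR0. Qed.

Lemma continuous_expi : continuous expi.
Proof.
rewrite (_ : expi = fun t => cos t +i* sin t); last first.
  by apply/funext => t; rewrite expiE.
by apply: continuous_ReIm; [exact: continuous_cos|exact: continuous_sin].
Qed.

(** A weak form of Jordan's inequality.  By the mean value theorem,
    [sin (x / 2)] is at least [(x / 2) * cos (x / 2)], so [sin x] is at least
    [x * cos (x / 2) ^+ 2 = x * (1 + cos x) / 2]. *)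
Lemma sin_ge_half x : 0 <= x -> x <= pi / 2 -> x / 2 <= sin x.
Proof.
move=> x0 xpi; have pi0 := pi_gt0 R.
have [||c Hc0 Hc] := @MVT_segment R (@sin R) (@cos R) 0 (x / 2).
- by rewrite divr_ge0.
- exact/continuous_subspaceT/continuous_sin.
move: Hc0; rewrite in_itv /= => /andP[c0 cx]; rewrite sin0 !subr0 in Hc.
have cosc : cos (x / 2) <= cos c.
  by rewrite leNgt ltr_cos -?leNgt// in_itv /=; apply/andP; split; lra.
have cos0x : 0 <= cos x by apply: cos_ge0_pihalf; lra.
have cosh : 0 <= cos (x / 2) by apply: cos_ge0_pihalf; lra.
have E1 : sin x = 2 * (cos (x / 2) * sin (x / 2)).
  by rewrite mulr_natl -sin_mulr2n; congr sin; rewrite -mulr_natr; field.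
have E2 : cos x = 2 * cos (x / 2) ^+ 2 - 1.
  by rewrite mulr_natl -cos_mulr2n; congr cos; rewrite -mulr_natr; field.
rewrite E1 Hc.
have : cos (x / 2) ^+ 2 * (x / 2) <= cos (x / 2) * (cos c * (x / 2)).
  by rewrite expr2 -mulrA ler_wpM2l// ler_wpM2r// divr_ge0.
nra.
Qed.

Lemma sin_eq0_small (y : R) : - pi < y < pi -> sin y = 0 -> y = 0.
Proof.
move=> /andP[y1 y2] sy; have [y0|y0|//] := ltgtP y 0.
- have : 0 < sin (- y) by apply: sin_gt0_pi; lra.
  by rewrite sinN sy oppr0 ltxx.
- have : 0 < sin y by apply: sin_gt0_pi; rewrite y0.
  by rewrite sy ltxx.
Qed.

Lemma normc_expiB t s : normc (expi t - expi s) = 2 * `|sin ((t - s) / 2)|.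
Proof.
apply/eqP; rewrite -(eqrXn2 (n := 2)) ?normc_ge0 ?mulr_ge0//; apply/eqP.
rewrite normc_sqr !expiE /= exprMn real_normK ?num_real//.
have E2 : cos (t - s) = 1 - 2 * sin ((t - s) / 2) ^+ 2.
  have {1}-> : t - s = ((t - s) / 2) *+ 2 by rewrite -mulr_natr; field.
  by rewrite cos_mulr2n cos2sin2; ring.
have -> : 2 ^+ 2 * sin ((t - s) / 2) ^+ 2 = 2 * (1 - cos (t - s)).
  by rewrite E2; ring.
have := cos2Dsin2 t; have := cos2Dsin2 s; rewrite cosB; nra.
Qed.

(** The hypotheses on [m] bound it by the lengths of the two arcs between the
    points.  The chord equals [2 * sin (u / 2)] with [u = `|t - s|], and
    [sin_ge_half] applies to [u / 2] or to [pi - u / 2]. *)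
Lemma normc_expiB_ge t s m : 0 <= t <= 2 * pi -> 0 <= s <= 2 * pi ->
  m <= `|t - s| -> m <= 2 * pi - `|t - s| -> m / 2 <= normc (expi t - expi s).
Proof.
move=> /andP[t0 tp] /andP[s0 sp] m1 m2; rewrite normc_expiB.
set u := `|t - s| in m1 m2 *.
have u0 : 0 <= u by exact: normr_ge0.
have u2 : u <= 2 * pi by rewrite ler_norml; lra.
have -> : `|sin ((t - s) / 2)| = `|sin (u / 2)|.
  rewrite /u; have [h|h] := leP 0 (t - s); first by rewrite (ger0_norm h).
  by rewrite (ltr0_norm h) mulNr sinN normrN.
apply: (@le_trans _ _ (2 * sin (u / 2))); last by rewrite ler_wpM2l// ler_norm.
have [h|h] := leP (u / 2) (pi / 2).
  have /(_ _ h) : 0 <= u / 2 -> _ := @sin_ge_half (u / 2); lra.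
have -> : sin (u / 2) = sin (pi - u / 2).
  by rewrite sinB sinpi cospi mul0r sub0r mulN1r opprK.
have : (pi - u / 2) / 2 <= sin (pi - u / 2) by apply: sin_ge_half; lra.
lra.
Qed.

Lemma circle_expi (a : R[i]) : normc a = 1 ->
  exists2 t, 0 <= t < 2 * pi & a = expi t.
Proof.
move=> a1; have := normc_sqr a; rewrite a1 expr1n.
case: a {a1} => x y /= xy; have pi0 := pi_gt0 R.
have x1 : -1 <= x <= 1 by have := sqr_ge0 y; nra.
have sE : Num.sqrt (1 - x ^+ 2) = `|y|.
  by rewrite xy addrC addKr sqrtr_sqr.
have := acos_ge0 x1; have := acos_lepi x1; have := sin_acos x1.
have cE : cos (acos x) = x by rewrite acosK.
rewrite sE; have [y0|y0] := leP 0 y => sa al ag.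
  exists (acos x); first by lra.
  by rewrite expiE cE sa ger0_norm.
exists (2 * pi - acos x).
  apply/andP; split; first by lra.
  rewrite ltrBlDr ltrDl lt_neqAle ag andbT eq_sym; apply/eqP => a0.
  by move: sa; rewrite a0 sin0 ltr0_norm//; lra.
have -> : 2 * pi = pi *+ 2 :> R by rewrite mulr_natl.
rewrite expiE cosB sinB cos2pi sin2pi cE sa !mul0r !mul1r addr0 sub0r.
by rewrite ltr0_norm// opprK.
Qed.

(** An affine function of the plane, equal to zero on the line through
    [expi t1] and [expi t2]; by [chord_expi], its sign on the circle is the
    product of the signs of two sines. *)
Definition chord (t1 t2 : R) (z : R[i]) : R :=
  cos ((t2 - t1) / 2) -
  (complex.Re z * cos ((t1 + t2) / 2) + complex.Im z * sin ((t1 + t2) / 2)).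

Lemma chord_expi t1 t2 t :
  chord t1 t2 (expi t) = 2 * (sin ((t - t1) / 2) * sin ((t - t2) / 2)).
Proof.
rewrite /chord expiE /= -cosB.
have -> : (t2 - t1) / 2 = (t - t1) / 2 - (t - t2) / 2 by field.
have -> : t - (t1 + t2) / 2 = (t - t1) / 2 + (t - t2) / 2 by field.
rewrite cosB cosD; ring.
Qed.

Lemma continuous_chord t1 t2 : continuous (chord t1 t2).
Proof.
move=> z; rewrite /chord; apply: (@cvgB R R^o R[i] (nbhs z) (nbhs_filter z)).
  exact: cvg_cst.
apply: (@cvgD R R^o R[i] (nbhs z) (nbhs_filter z));
  apply: (@cvgMl R R[i] (nbhs z) (nbhs_filter z)).
- exact: continuous_Re.
- exact: continuous_Im.
Qed.
End circle_geometry.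

(** * Complementary arcs and gaps between angles *)

Lemma esum_subset (R : realType) (T : choiceType) (A B : set T)
    (a : T -> \bar R) :
  A `<=` B -> (\esum_(i in A) a i <= \esum_(i in B) a i)%E.
Proof.
move=> AB; apply: ge_ereal_sup => _ [X [finX XA] <-].
by apply: esum_ge; exists X => //; split => //; exact: subset_trans AB.
Qed.

(** The Lebesgue measure of an arbitrary set is its outer measure, whence
    monotonicity without measurability. *)
Lemma le_lebesgue_measure (R : realType) (A B : set R) : A `<=` B ->
  (lebesgue_measure A <= lebesgue_measure B)%E.
Proof. by move=> AB; exact: le_mu_ext. Qed.

Section complementary_arcs.
Variable R : realType.
Variable E : set R[i].
Hypotheses (E_closed : closed E) (E_circle : E `<=` @unit_circle R).
Local Notation normc := (@Normc.normc R).

(** Leaving out the angle 0 as well makes the components real intervals, even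
    when [1] is not in [E]; the arc through [1] is then cut in two. *)
Definition gap_angles : set R := [set t | 0 < t < 2 * pi /\ ~ E (expi t)].

Lemma open_gap_angles : open gap_angles.
Proof.
rewrite (_ : gap_angles = `]0, 2 * pi[%classic `&` (@expi R) @^-1` (~` E)).
  apply: openI; first exact: interval_open.
  by have /continuousP := @continuous_expi R; apply; exact: closed_openC.
by apply/seteqP; split => t /=; rewrite in_itv.
Qed.

(** Some of the gaps may be empty, and then both of their end points are 0. *)
Definition gap k : set R := open_disjoint_itv open_gap_angles k.
Definition gapl k := inf (gap k).
Definition gapr k := sup (gap k).

Lemma gap_sub k : gap k `<=` gap_angles.
Proof.
move=> t kt; rewrite [gap_angles](open_disjoint_itv_bigcup open_gap_angles).
by exists k.
Qed.

Lemma gapE k : gap k = [set t | gapl k < t < gapr k].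
Proof.
rewrite -interval_bounded_interior.
- exact/esym/interior_id/open_disjoint_itv_open.
- exact: open_disjoint_itv_is_interval.
- by exists 0 => t /gap_sub[/andP[/ltW]].
- by exists (2 * pi) => t /gap_sub[/andP[_ /ltW]].
Qed.

Lemma gap_disjoint k l t : gap k t -> gap l t -> k = l.
Proof.
move=> kt lt.
apply: (@open_disjoint_itv_trivIset _ _ open_gap_angles) => //.
by exists t.
Qed.

Lemma gap_bounds k : gap k !=set0 ->
  [/\ 0 <= gapl k, gapl k < gapr k & gapr k <= 2 * pi].
Proof.
move=> [t kt]; move: (kt); rewrite gapE /= => /andP[lt tr].
have ne : gap k !=set0 by exists t.
split.
- by apply: lb_le_inf => // s /gap_sub[/andP[/ltW]].
- exact: lt_trans tr.
- by apply: ge_sup => // s /gap_sub[/andP[_ /ltW]].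
Qed.

Lemma gap_length0 k : ~ (gap k !=set0) -> gapr k - gapl k = 0.
Proof.
move/nonemptyPn => k0; rewrite /gapr /gapl k0 sup0 inf0 subrr//.
Qed.

(** If [gapl k] were the angle of a point outside [E], it would lie in some
    gap, and this open interval would meet [gap k] without being equal to
    it. *)
Lemma gapl_in_E k : gap k !=set0 -> 0 < gapl k -> E (expi (gapl k)).
Proof.
move=> kne l0; have [_ lr r2] := gap_bounds kne.
apply: contrapT => nE.
have : gap_angles (gapl k) by split=> //; rewrite l0 (lt_le_trans lr).
rewrite [gap_angles](open_disjoint_itv_bigcup open_gap_angles) => -[j _ jl].
have jl' : gap j (gapl k) by [].
move: (jl'); rewrite gapE /= => /andP[_ lj].
pose m := Num.min (gapr j) (gapr k).
have lm : gapl k < m by rewrite lt_min lj lr.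
pose s := (gapl k + m) / 2.
have ls : gapl k < s by rewrite /s; lra.
have sm : s < m by rewrite /s; lra.
move: (sm); rewrite lt_min => /andP[sj sk].
have kj : k = j.
  apply: (@gap_disjoint k j s); rewrite gapE /= ?ls ?sk//.
  move: jl'; rewrite gapE /= => /andP[+ _] => jlk.
  by rewrite sj (lt_trans jlk).
by move: jl'; rewrite -kj gapE /= ltxx.
Qed.

(** The angle of [a] is outside the gap, and so are 0 and [2 * pi]; hence both
    arcs from [expi t] to [a] pass through an end point of the gap. *)
Lemma gap_dist k t a : gap k t -> E a ->
  Num.min (t - gapl k) (gapr k - t) / 2 <= normc (expi t - a).
Proof.
move=> kt Ea; have a1 : normc a = 1.
  by have := E_circle Ea; rewrite unit_circleE.
have [s /andP[s0 s2] as_] := circle_expi a1.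
have kne : gap k !=set0 by exists t.
have [l0 lr r2] := gap_bounds kne.
have nks : ~ gap k s.
  by move=> /gap_sub[_]; rewrite -as_.
move: (kt); rewrite gapE /= => /andP[lt tr].
have sout : s <= gapl k \/ gapr k <= s.
  have [|ls] := leP s (gapl k); first by left.
  have [|sr] := leP (gapr k) s; first by right.
  by exfalso; apply: nks; rewrite gapE /= ls sr.
set m := Num.min _ _.
have m1 : m <= t - gapl k by rewrite ge_min lexx.
have m2 : m <= gapr k - t by rewrite ge_min lexx orbT.
rewrite as_; apply: normc_expiB_ge; rewrite ?s0 ?(ltW s2)//; first by lra.
- by have := ler_norm (t - s); have := ler_norm (s - t); rewrite distrC;
    case: sout; lra.
- have [ts|ts] := leP 0 (t - s).
    by rewrite ger0_norm//; lra.
  by rewrite ltr0_norm//; lra.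
Qed.

Definition arc_of k : set R[i] :=
  connected_component (@unit_circle R `\` E) (expi ((gapl k + gapr k) / 2)).

Lemma circle_expi_setD t : gap_angles t -> (@unit_circle R `\` E) (expi t).
Proof.
by move=> [_ nE]; split => //; rewrite unit_circleE; exact: normc_expi.
Qed.

Lemma gap_mid k : gap k !=set0 -> gap k ((gapl k + gapr k) / 2).
Proof. by move=> /gap_bounds[_ lr _]; rewrite gapE /=; lra. Qed.

Lemma arc_of_complementary k : gap k !=set0 ->
  complementary_arcs E (arc_of k).
Proof.
move=> kne; exists (expi ((gapl k + gapr k) / 2)) => //.
exact/circle_expi_setD/gap_sub/gap_mid.
Qed.

Lemma gap_sub_arc k t : gap k t -> arc_of k (expi t).
Proof.
move=> kt; have kne : gap k !=set0 by exists t.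
apply: (@connected_component_max _ _ ((@expi R) @` gap k)).
- by exists ((gapl k + gapr k) / 2) => //; exact: gap_mid.
- by move=> _ [s ks <-]; exact: circle_expi_setD (gap_sub ks).
- apply: connected_continuous_connected.
    exact/connected_intervalP/open_disjoint_itv_is_interval.
  by apply: continuous_subspaceT; exact: continuous_expi.
- by exists t.
Qed.

Lemma gap_le_arc_length k : gap k !=set0 ->
  ((gapr k - gapl k)%:E <= arc_length (arc_of k))%E.
Proof.
move=> kne; have [l0 lr r2] := gap_bounds kne.
apply: (@le_trans _ _ (lebesgue_measure (gap k))).
  rewrite gapE (_ : [set t | _] = `]gapl k, gapr k[%classic); last first.
    by apply/seteqP; split => t /=; rewrite in_itv.
  by rewrite lebesgue_measure_itv /= lte_fin lr.
apply: le_lebesgue_measure => t kt /=; split.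
  by have [/andP[t0 t2] _] := gap_sub kt; rewrite (ltW t0).
exact: gap_sub_arc.
Qed.

Lemma arc_length_le2pi (J : set R[i]) : (arc_length J <= (2 * pi)%:E)%E.
Proof.
apply: (@le_trans _ _ (lebesgue_measure `[0%R, 2 * pi : R]%classic)).
  apply: le_lebesgue_measure => t /= [/andP[t0 t2] _].
  by rewrite in_itv /= t0 ltW.
rewrite lebesgue_measure_itv /=; case: ifP => _.
  by rewrite sube0.
by rewrite lee_fin mulr_ge0// pi_ge0.
Qed.

(** On the circle, [chord t1 t2] vanishes only at two points of [E], so it has
    a constant sign on [J]; but its values at [expi s1] and [expi s2] have
    opposite signs. *)
Lemma chord_separates (J : set R[i]) t1 t2 s1 s2 :
  connected J -> J `<=` @unit_circle R `\` E ->
  0 <= t1 -> t2 < 2 * pi -> E (expi t1) -> E (expi t2) ->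
  t1 < s1 -> s1 < t2 -> t2 < s2 -> s2 < 2 * pi ->
  J (expi s1) -> J (expi s2) -> False.
Proof.
move=> cJ Jsub t10 t2pi E1 E2 ts1 st2 ts2 s2pi J1 J2.
have : connected (chord t1 t2 @` J).
  apply: connected_continuous_connected => //.
  by apply: continuous_subspaceT; exact: continuous_chord.
move/connected_intervalP => iJ.
have c1 : chord t1 t2 (expi s1) <= 0.
  rewrite chord_expi.
  have A : 0 < sin ((s1 - t1) / 2) by apply: sin_gt0_pi; lra.
  have : 0 < sin (- ((s1 - t2) / 2)) by apply: sin_gt0_pi; lra.
  rewrite sinN; nra.
have c2 : 0 <= chord t1 t2 (expi s2).
  rewrite chord_expi.
  have A : 0 < sin ((s2 - t1) / 2) by apply: sin_gt0_pi; lra.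
  have : 0 < sin ((s2 - t2) / 2) by apply: sin_gt0_pi; lra.
  nra.
have : (chord t1 t2 @` J) 0.
  by apply: (iJ (chord t1 t2 (expi s1)) (chord t1 t2 (expi s2)));
    [exists (expi s1)|exists (expi s2)|rewrite c1 c2].
move=> [z Jz]; have [cz nEz] := Jsub _ Jz.
have [s /andP[s0 s2'] zs] : exists2 t, 0 <= t < 2 * pi & z = expi t.
  by apply: circle_expi; rewrite unit_circleE in cz.
rewrite zs chord_expi => /eqP; rewrite mulf_eq0 pnatr_eq0/= mulf_eq0.
move=> /orP[] /eqP /sin_eq0_small H; apply: nEz; rewrite zs.
- suff -> : s = t1 by []. 
  have /H : - pi < (s - t1) / 2 < pi by lra.
  lra.
- suff -> : s = t2 by []. 
  have /H : - pi < (s - t2) / 2 < pi by lra.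
  lra.
Qed.

(** When [1] is not in [E], the gap that starts at 0 may share its arc with
    the gap that ends at [2 * pi]; it has to be left out for [arc_of] to be
    injective. *)
Definition inner_gaps : set nat := [set k | gap k !=set0 /\ 0 < gapl k].

(** The left ends of two inner gaps are angles of points of [E], and these two
    points separate the gaps on the circle. *)
Lemma arc_of_inj : set_inj inner_gaps arc_of.
Proof.
move=> k l; rewrite !inE => -[kne k0] [lne l0] kl; apply: contrapT => nkl.
wlog klt : k l kne k0 lne l0 kl nkl / gapl k <= gapl l.
  move=> W; have [h|/ltW h] := leP (gapl k) (gapl l); first exact: (W k l).
  by apply: (W l k) => // lk; apply: nkl.
have [kl0 klr kr2] := gap_bounds kne; have [ll0 llr lr2] := gap_bounds lne.
have rl : gapr k <= gapl l.
  rewrite leNgt; apply/negP => lk.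
  pose m := Num.min (gapr k) (gapr l).
  have lm : gapl l < m by rewrite lt_min lk llr.
  have sm : (gapl l + m) / 2 < m by lra.
  move: (sm); rewrite lt_min => /andP[sj sk].
  apply: nkl; apply: (@gap_disjoint k l ((gapl l + m) / 2)); rewrite gapE /=.
    by rewrite sj andbT; lra.
  by rewrite sk andbT; lra.
have mk := gap_mid kne; have ml := gap_mid lne.
have Jk := gap_sub_arc mk; have Jl := gap_sub_arc ml.
apply: (@chord_separates (arc_of k) (gapl k) (gapl l)
  ((gapl k + gapr k) / 2) ((gapl l + gapr l) / 2)) => //; try lra.
- exact: component_connected.
- exact: connected_component_sub.
- exact: gapl_in_E.
- exact: gapl_in_E.
- by rewrite kl.
Qed.

Lemma gap_unique0 k l : gap k !=set0 -> gap l !=set0 ->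
  gapl k = gapl l -> k = l.
Proof.
move=> kne lne kl.
have [_ klr _] := gap_bounds kne; have [_ llr _] := gap_bounds lne.
pose m := Num.min (gapr k) (gapr l).
have lm : gapl l < m by rewrite lt_min llr -kl klr.
have sm : (gapl l + m) / 2 < m by lra.
move: (sm); rewrite lt_min => /andP[sj sk].
by apply: (@gap_disjoint k l ((gapl l + m) / 2));
  rewrite gapE /= ?sj ?sk ?kl andbT; lra.
Qed.

(** The inner gaps inject into the complementary arcs, which are at least as
    long; passing from the exponent [1 - q] to [1 - b] costs the factor
    [(2 * pi) `^ (q - b)], as arcs have length at most [2 * pi].  The only
    other nonempty gap is the one starting at 0. *)
Lemma gaps_summable (q b : R) : b < 1 -> b <= q ->
  (\esum_(J in complementary_arcs E) (arc_length J `^ (1 - q)) < +oo)%E ->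
  (\sum_(k <oo) ((gapr k - gapl k) `^ (1 - b))%:E < +oo)%E.
Proof.
move=> b1 bq sumJ.
have a0 k : (0 <= ((gapr k - gapl k) `^ (1 - b))%:E)%E.
  by rewrite lee_fin powR_ge0.
rewrite nneseries_esumT// (esumID inner_gaps)// !setTI.
apply: lte_add_pinfty.
- have H k : inner_gaps k -> (((gapr k - gapl k) `^ (1 - b))%:E <=
      ((2 * pi) `^ (q - b))%:E * (arc_length (arc_of k) `^ (1 - q)))%E.
    move=> [kne _]; have [_ lr _] := gap_bounds kne.
    have := gap_le_arc_length kne; have := arc_length_le2pi (arc_of k).
    case: (arc_length _) => [x| |]//; rewrite !lee_fin => x2 rx.
    have x0 : 0 < x by rewrite (lt_le_trans _ rx)// subr_gt0.
    apply: (@le_trans _ _ (x `^ (1 - b))).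
      by rewrite ge0_ler_powR ?nnegrE ?subr_ge0 ?(ltW b1) ?(ltW lr) ?(ltW x0).
    have -> : 1 - b = (q - b) + (1 - q) by ring.
    rewrite powRD ?(gt_eqF x0) ?implybT// ler_wpM2r ?powR_ge0//.
    by rewrite ge0_ler_powR ?nnegrE ?subr_ge0// ?(ltW x0)// mulr_ge0 ?pi_ge0.
  apply: (le_lt_trans (le_esum H)).
  pose C : R := (2 * pi) `^ (q - b).
  rewrite -(esum_image inner_gaps arc_of
    (fun J => C%:E * (arc_length J `^ (1 - q)))%E); last exact: arc_of_inj.
  have aq0 J : (0 <= arc_length J `^ (1 - q))%E by exact: poweR_ge0.
  apply: (@le_lt_trans _ _
    (C%:E * \esum_(J in complementary_arcs E) (arc_length J `^ (1 - q)))%E).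
    apply: ge_ereal_sup => _ [X [finX XA] <-].
    rewrite -ge0_mule_fsumr//; apply: lee_wpmul2l.
      by rewrite lee_fin powR_ge0.
    apply: esum_ge; exists X => //; split => // J /XA[k [kne _] <-].
    exact: arc_of_complementary.
  by rewrite lte_mul_pinfty// lee_fin powR_ge0.
(* A nonempty gap that is not inner starts at 0; there is at most one. *)
- pose outer := [set k | gap k !=set0 /\ gapl k = 0].
  have outer1 k l : outer k -> outer l -> k = l.
    by move=> [kne k0] [lne l0]; apply: gap_unique0 => //; rewrite k0 l0.
  have fin_outer : finite_set outer.
    have [[k ok]|/nonemptyPn->//] := pselect (outer !=set0).
    by apply: (sub_finite_set _ (finite_set1 k)) => l ol; exact: outer1.
  rewrite (esumID outer)// [X in (_ + X)%E]esum1 ?adde0; last first.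
    move=> k /= [nin nout].
    rewrite gap_length0 ?powR0 ?subr_eq0 ?gt_eqF// => kne.
    have [l0 _ _] := gap_bounds kne.
    have [kl|kl] := ltP 0 (gapl k); first exact: nin.
    by apply: nout; split => //; apply/eqP; rewrite eq_le kl.
  apply: (@le_lt_trans _ _
    (\esum_(k in outer) ((gapr k - gapl k) `^ (1 - b))%:E)%E).
    by apply: esum_subset => k [].
  rewrite -[outer]set_mem_set esum_fset ?set_mem_set//.
  by rewrite fsumEFin ?ltry.
Qed.
End complementary_arcs.

(** * Integrals with singularities at the end points *)

Section singular_integrals.
Variable R : realType.
Implicit Types (f F : R -> R) (s x y M : R).
Local Notation mu := (@lebesgue_measure R).

(** The open interval is exhausted by compact ones, on which the fundamental
    theorem of calculus applies; so [f] may be unbounded near both ends. *)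
Lemma integral_le_primitive f F (x y M : R) :
  {in `]x, y[, forall t : R, is_derive t (1 : R) F (f t)} ->
  {in `]x, y[, continuous f} -> {in `]x, y[, forall t : R, 0 <= f t} ->
  {in `]x, y[ &, forall u v : R, F v - F u <= M} ->
  x < y ->
  (\int[mu]_(t in `]x, y[) (f t)%:E <= M%:E)%E.
Proof.
move=> dF cf f0 FM xy.
(* With [n.+3], even the first compact interval is nondegenerate. *)
pose d n : R := (y - x) / n.+3%:R.
have xy0 : 0 < y - x by rewrite subr_gt0.
have d0 n : 0 < d n by rewrite divr_gt0.
have d3 n : d n *+ 3 <= y - x.
  by rewrite -mulr_natr mulrAC ler_pdivrMr// ler_pM2l// ler_nat.
pose S n := `[x + d n, y - d n]%classic.
have dle n m : (n <= m)%N -> d m <= d n.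
  by move=> nm; rewrite ler_pM2l// lef_pV2 ?posrE// ler_nat.
have Sxy n : S n `<=` `]x, y[%classic.
  by move=> t; rewrite /S /= !in_itv /=; have := d0 n; lra.
have US : `]x, y[%classic = \bigcup_n S n.
  apply/seteqP; split; last by move=> t [n _]; exact: Sxy.
  move=> t; rewrite /= in_itv /= => /andP[xt ty].
  pose e := Num.min (t - x) (y - t).
  have e0 : 0 < e by rewrite lt_min !subr_gt0 xt.
  pose n := Num.truncn ((y - x) / e).
  have dn : d n <= e.
    rewrite /d ler_pdivrMr// -ler_pdivrMl// mulrC.
    rewrite (le_trans (ltW (truncnS_gt _)))// ler_nat -/n.
    by rewrite ltnW// ltnW.
  exists n => //; rewrite /S /= in_itv /=.
  move: dn; rewrite le_min => /andP[]; lra.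
have mf : measurable_fun `]x, y[%classic f.
  apply: open_continuous_measurable_fun; first exact: interval_open.
  by move=> t; rewrite inE; exact: cf.
have ndS : nondecreasing_seq S.
  move=> n m nm; apply/subsetPset => t; rewrite /S /= !in_itv /=.
  by have := dle _ _ nm; lra.
have cvgS := @ge0_nondecreasing_set_cvg_integral _ (measurableTypeR R) R S
  (EFin \o f) mu ndS.
rewrite US; rewrite -[X in (X <= _)%E](cvg_lim _ (cvgS _ _ _))//; last 3 first.
- by move=> n; exact: measurable_itv.
- move=> n; apply/measurable_EFinP.
  by apply: measurable_funS mf => //; exact: measurable_itv.
- by move=> n t /Sxy /f0; rewrite lee_fin.
apply: lime_le.
  apply/cvg_ex; eexists; apply: cvgS.
  - by move=> n; exact: measurable_itv.
  - move=> n; apply/measurable_EFinP.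
    by apply: measurable_funS mf => //; exact: measurable_itv.
  - by move=> n t /Sxy /f0; rewrite lee_fin.
apply: nearW => n.
have dn0 := d0 n; have dn3 := d3 n.
have xin : x + d n \in `]x, y[ by rewrite in_itv /=; lra.
have yin : y - d n \in `]x, y[ by rewrite in_itv /=; lra.
have inS t : t \in `](x + d n), (y - d n)[ -> t \in `]x, y[.
  by rewrite !in_itv /=; lra.
have cF t : t \in `]x, y[ -> {for t, continuous F}.
  move=> /dF dFt; apply/differentiable_continuous/derivable1_diffP.
  exact: ex_derive.
rewrite (@continuous_FTC2 R f F).
- by rewrite -EFinB lee_fin; exact: FM.
- by lra.
- apply: continuous_in_subspaceT => t; rewrite inE => /Sxy.
  exact: cf.
- split.
  + by move=> t /inS /dF dFt; exact: ex_derive.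
  + exact/cvg_at_right_filter/cF.
  + exact/cvg_at_left_filter/cF.
- by move=> t /inS /dF dFt; rewrite derive1E derive_val.
Qed.

Lemma is_derive_powR_subr (a x t : R) : x < t ->
  is_derive t (1 : R) (fun t : R => (t - x) `^ a) (a * (t - x) `^ (a - 1)).
Proof.
move=> xt; rewrite -[X in is_derive _ _ _ X]mulr1.
apply: (@is_derive1_comp R (@powR R ^~ a) (fun t => t - x) t).
  by apply: is_derive1_powR; rewrite subr_gt0.
by apply: is_derive_eq; rewrite subr0.
Qed.

Lemma is_derive_powR_rsub (a y t : R) : t < y ->
  is_derive t (1 : R) (fun t : R => (y - t) `^ a) (- (a * (y - t) `^ (a - 1))).
Proof.
move=> ty; rewrite -[X in is_derive _ _ _ X]mulrN1.
apply: (@is_derive1_comp R (@powR R ^~ a) (fun t => y - t) t).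
  by apply: is_derive1_powR; rewrite subr_gt0.
by apply: is_derive_eq; rewrite add0r mul1r.
Qed.

(** Equivalent to [Num.min (t - x) (y - t) `^ (- s)], but with an explicit
    primitive. *)
Definition end_weight s x y t : R := (t - x) `^ (- s) + (y - t) `^ (- s).

Lemma end_weight_ge0 s x y t : 0 <= end_weight s x y t.
Proof. by rewrite addr_ge0 ?powR_ge0. Qed.

Lemma measurable_end_weight s x y D : measurable_fun D (end_weight s x y).
Proof.
apply: measurable_funTS; apply: measurable_funD;
  apply: (measurableT_comp (f := @powR R ^~ (- s))) (measurable_powR _) _.
- exact: measurable_funB.
- exact: measurable_funB.
Qed.

Lemma integral_end_weight s x y : 0 < s -> s < 1 -> x <= y ->
  (\int[mu]_(t in `]x, y[) (end_weight s x y t)%:E <=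
   (2 / (1 - s) * (y - x) `^ (1 - s))%:E)%E.
Proof.
move=> s0 s1; rewrite le_eqVlt => /orP[/eqP <-|xy].
  rewrite set_itvoo0 integral_set0 lee_fin mulr_ge0 ?powR_ge0// divr_ge0//.
  by rewrite subr_ge0 ltW.
have s1' : 0 < 1 - s by rewrite subr_gt0.
have isd t : t \in `]x, y[ -> 
    is_derive t 1
      (fun t => (1 - s)^-1 * ((t - x) `^ (1 - s) - (y - t) `^ (1 - s)))
      (end_weight s x y t).
  rewrite in_itv /= => /andP[xt ty].
  have D1 := is_derive_powR_subr (1 - s) xt.
  have D2 := is_derive_powR_rsub (1 - s) ty.
  have -> : end_weight s x y t = (1 - s)^-1 *
     ((1 - s) * (t - x) `^ (1 - s - 1) - - ((1 - s) * (y - t) `^ (1 - s - 1))).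
    rewrite /end_weight (_ : 1 - s - 1 = - s); last by ring.
    by field; rewrite gt_eqF.
  exact: is_deriveZ.
apply: (@integral_le_primitive _ _ x y _ isd) => //.
- move=> t; rewrite in_itv /= => /andP[xt ty].
  apply/differentiable_continuous/derivable1_diffP.
  have D1 := is_derive_powR_subr (- s) xt.
  have D2 := is_derive_powR_rsub (- s) ty.
  exact: (@derivableD R R^o R^o (fun t => (t - x) `^ (- s))
    (fun t => (y - t) `^ (- s)) t 1 (@ex_derive _ _ _ _ _ _ _ D1)
    (@ex_derive _ _ _ _ _ _ _ D2)).
- by move=> t _; exact: end_weight_ge0.
- move=> u v; rewrite !in_itv /= => /andP[xu uy] /andP[xv vy].
  rewrite -mulrBr [2 / _]mulrC -mulrA ler_wpM2l ?invr_ge0 ?(ltW s1')//.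
  have H1 : (v - x) `^ (1 - s) <= (y - x) `^ (1 - s).
    by rewrite ge0_ler_powR ?nnegrE ?(ltW s1')//; lra.
  have H2 : (y - u) `^ (1 - s) <= (y - x) `^ (1 - s).
    by rewrite ge0_ler_powR ?nnegrE ?(ltW s1')//; lra.
  have H3 := powR_ge0 (u - x) (1 - s); have H4 := powR_ge0 (y - v) (1 - s).
  lra.
Qed.

Lemma powR_min_le s u v :
  (Num.min u v) `^ (- s) <= u `^ (- s) + v `^ (- s).
Proof.
have [uv|vu] := leP u v.
  by rewrite lerDl powR_ge0.
by rewrite lerDr powR_ge0.
Qed.

Lemma powRN_le s u v : 0 <= s -> 0 < u -> u <= v -> v `^ (- s) <= u `^ (- s).
Proof.
move=> s0 u0 uv; have v0 := lt_le_trans u0 uv.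
rewrite !powRN lef_pV2 ?posrE ?powR_gt0//.
by rewrite ge0_ler_powR ?nnegrE ?(ltW u0) ?(ltW v0).
Qed.
End singular_integrals.

(** * Riesz potentials on the circle *)

Section riesz_potential.
Variable R : realType.
Local Notation normc := (@Normc.normc R).
Local Notation leb := (@lebesgue_measure R).
Local Open Scope complex_scope.
Implicit Types (s t : R) (a : R[i]).

Lemma cmeasurable_comp d d' (T : measurableType d) (U : measurableType d')
    (f : U -> R[i]) (g : T -> U) :
  cmeasurable f -> measurable_fun setT g -> cmeasurable (f \o g).
Proof.
by move=> [f1 f2] mg; split;
  [exact: (measurableT_comp f1 mg)|exact: (measurableT_comp f2 mg)].
Qed.

Lemma cmeasurable_expi : cmeasurable (@expi R : measurableTypeR R -> R[i]).
Proof.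
split.
- rewrite (_ : _ \o _ = @cos R).
    exact: continuous_measurable_fun (@continuous_cos R).
  by apply/funext => t; rewrite /comp expiE.
- rewrite (_ : _ \o _ = @sin R).
    exact: continuous_measurable_fun (@continuous_sin R).
  by apply/funext => t; rewrite /comp expiE.
Qed.

Definition riesz_kernel s t a : R := normc (expi t - a) `^ (- s).

Lemma measurable_riesz_kernel s :
  measurable_fun setT
    (fun p : measurableTypeR R * R[i] => riesz_kernel s p.1 p.2).
Proof.
apply: (measurableT_comp (f := @powR R ^~ (- s))
  (g := fun p : measurableTypeR R * R[i] => normc (expi p.1 - p.2))).
  exact: measurable_powR.
apply: cmeasurable_normc; apply: cmeasurableD.
  exact: (cmeasurable_comp cmeasurable_expi measurable_fst).
rewrite (_ : (fun _ => _) =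
    fun p : measurableTypeR R * R[i] => -1 * p.2); last first.
  by apply/funext => p; rewrite mulN1r.
apply: cmeasurableM; first exact: cmeasurable_cst.
exact: (cmeasurable_comp (@cmeasurable_id R) measurable_snd).
Qed.

Lemma measurable_riesz_kernel1 s a : measurable_fun setT (riesz_kernel s ^~ a).
Proof. exact: (measurable_fun_pair1 a (measurable_riesz_kernel s)). Qed.

Lemma measurable_riesz_kernel2 s t : measurable_fun setT (riesz_kernel s t).
Proof.
exact: (measurable_fun_pair2 (t : measurableTypeR R)
  (measurable_riesz_kernel s)).
Qed.

Definition riesz_const s : R := 4 / (1 - s) * (2 `^ s * (2 * pi) `^ (1 - s)).

(** Let [c] be the angle of [a].  On either side of [c], the distance from
    [expi t] to [a] is at least half the distance from [t] to the end points
    of the interval from 0 to [c], respectively from [c] to [2 * pi].  An end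
    weight on each of these two intervals thus dominates the kernel. *)
Lemma integral_riesz_kernel s a : 0 < s -> s < 1 -> normc a = 1 ->
  (\int[leb]_(t in `]0%R, (2 * pi)%R[) (riesz_kernel s t a)%:E <=
   (riesz_const s)%:E)%E.
Proof.
move=> s0 s1 /circle_expi[c /andP[c0 c2] ->].
have mk (D : set (measurableTypeR R)) :
    measurable_fun D (fun t => (riesz_kernel s t (expi c))%:E).
  apply/measurable_EFinP; apply: measurable_funTS.
  exact: measurable_riesz_kernel1.
have k0 t : (0 <= (riesz_kernel s t (expi c))%:E)%E by rewrite lee_fin powR_ge0.
have two_s : 0 <= 2 `^ s :> R by rewrite powR_ge0.
have pi0 := pi_gt0 R.
have piece x y : 0 <= x -> x <= y -> y <= 2 * pi -> c = x \/ c = y ->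
    (\int[leb]_(t in `]x, y[) (riesz_kernel s t (expi c))%:E <=
     (2 / (1 - s) * (2 `^ s * (2 * pi) `^ (1 - s)))%:E)%E.
  move=> x0 xy y2 cxy.
  apply: (@le_trans _ _ (\int[leb]_(t in `]x, y[)
      ((2 `^ s)%:E * (end_weight s x y t)%:E))%E).
    apply: ge0_le_integral => //.
    - apply: measurable_funeM; apply/measurable_EFinP.
      exact: measurable_end_weight.
    - move=> t; rewrite /= in_itv /= => /andP[xt ty].
      rewrite -EFinM lee_fin /riesz_kernel.
      have tx0 : 0 < t - x by rewrite subr_gt0.
      have yt0 : 0 < y - t by rewrite subr_gt0.
      set m := Num.min (t - x) (y - t).
      have m0 : 0 < m by rewrite lt_min tx0.
      have m1 : m <= t - x by rewrite ge_min lexx.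
      have m2 : m <= y - t by rewrite ge_min lexx orbT.
      apply: (@le_trans _ _ ((m / 2) `^ (- s))).
        apply: powRN_le; [exact: ltW|by rewrite divr_gt0|].
        apply: normc_expiB_ge; rewrite ?c0 ?(ltW c2)//.
        + by rewrite (le_trans x0 (ltW xt)) (le_trans (ltW ty)).
        + by have := ler_norm (t - c); have := ler_norm (c - t);
            rewrite distrC; case: cxy; lra.
        + by have [h|h] := leP 0 (t - c);
            [rewrite ger0_norm//|rewrite ltr0_norm//]; case: cxy; lra.
      rewrite powRM ?invr_ge0 ?(ltW m0)// mulrC -powR_inv1// -powRrM.
      rewrite mulN1r opprK.
      by rewrite ler_wpM2l// powR_min_le.
  rewrite ge0_integralZl//; last 2 first.
  - by apply/measurable_EFinP; exact: measurable_end_weight.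
  - by move=> t _; rewrite lee_fin end_weight_ge0.
  apply: (@le_trans _ _ ((2 `^ s)%:E *
     (2 / (1 - s) * (y - x) `^ (1 - s))%:E)%E).
    by apply: lee_wpmul2l => //; exact: integral_end_weight.
  rewrite -EFinM lee_fin mulrCA ler_wpM2l ?divr_ge0 ?subr_ge0 ?(ltW s1)//.
  rewrite ler_wpM2l// ge0_ler_powR ?nnegrE ?subr_ge0 ?(ltW s1)//; lra.
apply: (@le_trans _ _ (\int[leb]_(t in `]0%R, c[ `|` `[c, (2 * pi)%R[)
    (riesz_kernel s t (expi c))%:E)%E).
  apply: ge0_subset_integral => //; first exact: measurableU.
  move=> t; rewrite /= !in_itv /= => /andP[t0 t2].
  by have [tc|tc] := ltP t c; [left|right]; rewrite ?t0 ?tc.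
rewrite ge0_integral_setU//; last first.
  apply/disj_setPS => t [] /=; rewrite !in_itv /= => /andP[_ tc] /andP[ct _].
  by move: (lt_le_trans tc ct); rewrite ltxx.
rewrite (@integral_itv_bndoo R c (2 * pi) _ true true (mk _))//.
rewrite /riesz_const (_ : 4 / (1 - s) = 2 / (1 - s) + 2 / (1 - s)); last first.
  by rewrite -mulrDl; congr (_ / _); ring.
rewrite [X in (_ <= X%:E)%E]mulrDl EFinD leeD//.
- by apply: piece => //; [exact: ltW|right].
- by apply: piece => //; [exact: ltW|left].
Qed.

Variable mu : {finite_measure set R[i] -> \bar R}.
Variable E : set R[i].
Hypotheses (mE : measurable E) (E_circle : E `<=` @unit_circle R).

Definition riesz_potential s t : \bar R :=
  (\int[mu]_(a in E) (riesz_kernel s t a)%:E)%E.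

Lemma riesz_potential_ge0 s t : (0 <= riesz_potential s t)%E.
Proof. by apply: integral_ge0 => a _; rewrite lee_fin powR_ge0. Qed.

Let D : set (measurableTypeR R) := `]0%R, (2 * pi)%R[%classic.
(** Cutting the kernel off outside [D `*` E] allows Tonelli's theorem to be
    applied on the whole product. *)
Let k s : measurableTypeR R * R[i] -> \bar R :=
  (fun p => (riesz_kernel s p.1 p.2)%:E) \_ (D `*` E).

Let measurable_k s : measurable_fun setT (k s).
Proof.
apply/(measurable_restrictT _ _).1.
  by apply: measurableX => //; exact: measurable_itv.
apply/measurable_EFinP; apply: measurable_funTS; exact: measurable_riesz_kernel.
Qed.

Let k_ge0 s p : (0 <= k s p)%E.
Proof. by apply: erestrict_ge0 => q _; rewrite lee_fin powR_ge0. Qed.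

Let riesz_potential_restrict s :
  (riesz_potential s \_ D) = fun t => (\int[mu]_a k s (t, a))%E.
Proof.
apply/funext => t; rewrite patchE /k; case: ifPn => [tD|tD].
  rewrite /riesz_potential integral_mkcond; apply: eq_integral => a _.
  rewrite !patchE; congr (if _ then _ else _).
  by rewrite in_setX tD.
rewrite integral0_eq// => a _; rewrite patchE in_setX.
by rewrite (negbTE tD).
Qed.

Lemma measurable_riesz_potential s :
  measurable_fun `]0%R, (2 * pi)%R[ (riesz_potential s).
Proof.
apply/(measurable_restrictT _ _).2 => //.
rewrite riesz_potential_restrict.
exact: (measurable_fun_fubini_tonelli_F (k s) (measurable_k s) (k_ge0 s)).
Qed.

(** By Tonelli's theorem, as the inner integrals are bounded uniformly on [E]
    by [integral_riesz_kernel]. *)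
Lemma integral_riesz_potential s : 0 < s -> s < 1 ->
  (\int[leb]_(t in `]0%R, (2 * pi)%R[) riesz_potential s t < +oo)%E.
Proof.
move=> s0 s1; rewrite integral_mkcond riesz_potential_restrict.
rewrite (fubini_tonelli (k s) (measurable_k s) (k_ge0 s)).
apply: (@le_lt_trans _ _ (\int[mu]_(a in E) (riesz_const s)%:E)%E); last first.
  rewrite integral_cst// lte_mul_pinfty//.
  - rewrite lee_fin !mulr_ge0 ?powR_ge0 ?invr_ge0 ?subr_ge0 ?(ltW s1)//.
  - by rewrite ltey_eq fin_num_measure.
rewrite [leRHS]integral_mkcond; apply: ge0_le_integral => //.
- by move=> a _; apply: integral_ge0 => t _; exact: k_ge0.
- exact: (measurable_fun_fubini_tonelli_G (k s) (measurable_k s) (k_ge0 s)).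
- by apply/(measurable_restrictT _ _).1.
move=> a _; rewrite patchE; case: ifPn => aE; last first.
  rewrite integral0_eq// => t _; rewrite /k patchE in_setX.
  by rewrite (negbTE aE) andbF.
rewrite (_ : (\int[leb]_t k s (t, a))%E =
  (\int[leb]_(t in `]0%R, (2 * pi)%R[) (riesz_kernel s t a)%:E)%E).
  apply: integral_riesz_kernel => //.
  by move: aE; rewrite inE => /E_circle; rewrite unit_circleE.
rewrite [RHS]integral_mkcond; apply: eq_integral => t _.
by rewrite /k !patchE in_setX aE andbT.
Qed.
End riesz_potential.

(** * Pointwise bounds on a concentric circle *)

Section radial_bound.
Variable R : realType.
Local Notation normc := (@Normc.normc R).
Local Notation leb := (@lebesgue_measure R).
Local Open Scope complex_scope.
Variable mu : {finite_measure set R[i] -> \bar R}.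
Variable E : set R[i].
Hypotheses (E_closed : closed E) (E_circle : E `<=` @unit_circle R)
  (mu_supp : mu (~` E) = 0%E).

Let mE : measurable E := closed_measurableC E_closed.

Lemma normc_radial (r t : R) : 0 <= r -> normc (r%:C * expi t) = r.
Proof.
by move=> r0; rewrite Normc.normcM normc_real normc_expi mulr1 ger0_norm.
Qed.

(** Going from the radial point to [expi t] covers a distance [1 - r], and the
    radial point is at least that far from the circle, in particular from
    [a]. *)
Lemma radial_dist (r t : R) a : 0 <= r < 1 -> @unit_circle R a ->
  normc (expi t - a) <= 2 * normc (a - r%:C * expi t).
Proof.
move=> /andP[r0 r1] ca; set z := r%:C * expi t.
have H1 := circle_dist z ca; rewrite normc_radial// in H1.
have H2 : normc (expi t - z) = 1 - r.
  rewrite (_ : _ - _ = (1 - r)%:C * expi t).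
    by rewrite normc_radial// subr_ge0 ltW.
  by rewrite rmorphB mulrBl mul1r.
have := ler_normcD (expi t - z) (z - a).
rewrite addrA subrK H2 [X in _ <= _ + X -> _]normcBC; lra.
Qed.

(** Strict only at [+oo], where [fine] is 0. *)
Lemma EFin_fine_le (x : \bar R) : (0 <= x -> (fine x)%:E <= x)%E.
Proof. by case: x => //= [_]; rewrite leey. Qed.

Lemma integral_circle_supp (f : R[i] -> \bar R) :
  measurable_fun setT f -> (forall a, 0 <= f a)%E ->
  (\int[mu]_(a in @unit_circle R) f a = \int[mu]_(a in E) f a)%E.
Proof.
move=> mf f0; rewrite (ge0_negligible_integral (measurableC mE))//.
- by rewrite setDE setCK setIidr.
- exact: measurable_unit_circle.
- exact: measurable_funTS.
Qed.

(** In [|a - expi t| ^ -2], the factor of exponent [- s] is kept under the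
    integral, while the factor of exponent [s - 2] is bounded by means of [m].
    The constant is 4 times the square of the factor 2 of [radial_dist]. *)
Lemma derive1_singular_inner_le_potential (s r t m : R) :
  0 <= r < 1 -> s < 1 -> 0 < m ->
  (forall a, E a -> m / 2 <= normc (expi t - a)) ->
  ((normc (derive1 (singular_inner mu) (r%:C * expi t)))%:E <=
   (16 * (m / 2) `^ (s - 2))%:E * riesz_potential mu E s t)%E.
Proof.
move=> /andP[r0 r1] s1 m0 mdist; set z := r%:C * expi t.
have z1 : normc z < 1 by rewrite normc_radial.
have m20 : 0 < m / 2 by rewrite divr_gt0.
pose g a := (normc (a - z))^-1 ^+ 2.
have mg : measurable_fun setT g.
  apply: measurable_funX; apply: measurable_funV.
    by move=> a; exact: normc_ge0.
  apply: (@cmeasurable_normc _ R[i] R (fun a => a - z)).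
  by apply: cmeasurableD; [exact: cmeasurable_id|exact: cmeasurable_cst].
have g0 a : 0 <= g a by rewrite sqr_ge0.
have kint : measurable_fun E (fun a => (riesz_kernel s t a)%:E).
  apply/measurable_EFinP; apply: measurable_funTS.
  exact: measurable_riesz_kernel2.
have k0 a : (0 <= (riesz_kernel s t a)%:E)%E by rewrite lee_fin powR_ge0.
apply: (@le_trans _ _ (4%:E * \int[mu]_(a in @unit_circle R) (g a)%:E)%E).
  have := normc_derive1_singular_inner mu z1; rewrite -lee_fin EFinM.
  move=> /le_trans; apply; apply: lee_wpmul2l => //.
  apply: EFin_fine_le; apply: integral_ge0 => a _.
  by rewrite lee_fin; exact: g0.
rewrite integral_circle_supp; last 2 first.
- exact/measurable_EFinP.
- by move=> a; rewrite lee_fin; exact: g0.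
apply: (@le_trans _ _ (4%:E * \int[mu]_(a in E)
    ((4 * (m / 2) `^ (s - 2))%:E * (riesz_kernel s t a)%:E))%E).
  apply: lee_wpmul2l => //; apply: ge0_le_integral => //.
  - by move=> a _; rewrite lee_fin; exact: g0.
  - by apply/measurable_EFinP; exact: measurable_funTS.
  - by apply: measurable_funeM.
  move=> a Ea; rewrite -EFinM lee_fin /riesz_kernel /g.
  have ma := mdist a Ea; set rho := normc (expi t - a) in ma *.
  have rho0 : 0 < rho by rewrite (lt_le_trans _ ma).
  have rz : rho <= 2 * normc (a - z).
    by apply: radial_dist; [rewrite r0|exact: E_circle].
  have az0 : 0 < normc (a - z) by lra.
  apply: (@le_trans _ _ (4 * rho `^ (s - 2) * rho `^ (- s))).
    rewrite -mulrA -powRD ?(gt_eqF rho0) ?implybT//.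
    rewrite (_ : s - 2 + - s = - 2%:R); last by ring.
    rewrite powR_invn ?(ltW rho0)// (_ : 4 = 2 ^+ 2); last by ring.
    rewrite -exprVn -exprMn lerXn2r ?nnegrE ?invr_ge0 ?mulr_ge0 ?invr_ge0
      ?normc_ge0 ?(ltW rho0)//.
    rewrite -[2 * _]invrK invfM invrK lef_pV2 ?posrE ?mulr_gt0 ?invr_gt0//.
    by rewrite mulrC ler_pdivrMr// mulrC.
  rewrite ler_wpM2r ?powR_ge0// ler_wpM2l//.
  by rewrite -[s - 2]opprB powRN_le// subr_ge0; lra.
rewrite ge0_integralZl// ?lee_fin ?mulr_ge0 ?powR_ge0//.
rewrite muleA -EFinM; apply: lee_wpmul2r; first exact: riesz_potential_ge0.
by rewrite lee_fin; lra.
Qed.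

(** In a weighted geometric mean, both terms may be replaced by the larger
    one. *)
Lemma powR_mean_le (u v p : R) : 0 < p -> p < 1 -> 0 <= u -> 0 <= v ->
  u `^ (1 - p) * v `^ p <= u + v.
Proof.
move=> p0 p1 u0 v0.
have e1 w : 0 <= w -> w `^ (1 - p) * w `^ p = w.
  move=> w0; rewrite -powRD; first by rewrite subrK powRr1.
  by rewrite subrK oner_eq0.
have [uv|/ltW vu] := leP u v.
  apply: (@le_trans _ _ v); last by rewrite lerDr.
  rewrite -[leRHS]e1// ler_wpM2r ?powR_ge0//.
  by rewrite ge0_ler_powR ?nnegrE// subr_ge0 ltW.
apply: (@le_trans _ _ u); last by rewrite lerDl.
rewrite -[leRHS]e1// ler_wpM2l ?powR_ge0//.
by rewrite ge0_ler_powR ?nnegrE// ltW.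
Qed.

(** The relation between the exponents turns [m `^ ((s - 2) * p)] into
    [(m `^ (- b)) `^ (1 - p)], so that the [p]-th power of the given bound is
    a weighted geometric mean of [m `^ (- b)] and [H]. *)
Lemma powR_potential_le (X m b s p : R) (H : \bar R) :
  0 < p -> p < 1 -> 0 <= X -> 0 < m -> (0 <= H)%E ->
  (2 - s) * p = b * (1 - p) ->
  (X%:E <= (16 * (m / 2) `^ (s - 2))%:E * H)%E ->
  ((X `^ p)%:E <= ((16 * 2 `^ (2 - s)) `^ p)%:E * ((m `^ (- b))%:E + H))%E.
Proof.
move=> p0 p1 X0 m0 H0 sb.
have C0 : 0 < 16 * 2 `^ (2 - s) :> R by rewrite mulr_gt0 ?powR_gt0.
have Cp : 0 < (16 * 2 `^ (2 - s)) `^ p by rewrite powR_gt0.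
case: H H0 => [h| |]//; rewrite ?lee_fin => h0; last first.
  by move=> _; rewrite addeC/= gt0_muley ?lte_fin// leey.
move=> XH.
have E1 : 16 * (m / 2) `^ (s - 2) * h = 16 * 2 `^ (2 - s) * (m `^ (s - 2) * h).
  rewrite powRM ?(ltW m0)// -powR_inv1// -powRrM mulN1r opprB; ring.
apply: (@le_trans _ _ ((16 * 2 `^ (2 - s) * (m `^ (s - 2) * h)) `^ p)).
  by rewrite -E1 ge0_ler_powR ?nnegrE ?(ltW p0)// ?mulr_ge0 ?powR_ge0.
rewrite powRM ?(ltW C0) ?mulr_ge0 ?powR_ge0// ler_wpM2l ?(ltW Cp)//.
rewrite powRM ?powR_ge0// -powRrM.
rewrite (_ : (s - 2) * p = - b * (1 - p)); last by rewrite mulNr -sb; ring.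
by rewrite powRrM powR_mean_le ?powR_ge0.
Qed.

(** The derivative is itself differentiable, hence continuous along the circle
    of radius [r]. *)
Lemma measurable_radial (r p : R) : 0 <= r < 1 ->
  measurable_fun setT (fun t : measurableTypeR R =>
    normc (derive1 (singular_inner mu) (r%:C * expi t)) `^ p).
Proof.
move=> /andP[r0 r1].
apply: (measurableT_comp (f := @powR R ^~ p)); first exact: measurable_powR.
apply: continuous_measurable_fun => t.
have z1 : normc (r%:C * expi t) < 1 by rewrite normc_radial.
have [l dl] := is_cderiv_derive1_singular_inner mu z1.
have ct : {for t, continuous (fun t : R => r%:C * expi t)}.
  rewrite (_ : (fun t => _) = fun t => (r * cos t) +i* (r * sin t)); last first.
    by apply/funext => u; rewrite expiE; simpc.
  apply: continuous_ReIm => u; apply: continuousM; try exact: cvg_cst.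
    exact: continuous_cos.
  exact: continuous_sin.
apply: (@continuous_comp _ _ _
  (fun t => derive1 (singular_inner mu) (r%:C * expi t)) normc).
  apply: (@continuous_comp _ _ _ (fun t => r%:C * expi t)); first exact: ct.
  exact: is_cderiv_continuous dl.
exact: continuous_normc.
Qed.
End radial_bound.

(** * The integral means *)

Section circle_mean.
Variable R : realType.
Local Notation normc := (@Normc.normc R).
Local Notation leb := (@lebesgue_measure R).
Local Open Scope complex_scope.
Variable mu : {finite_measure set R[i] -> \bar R}.
Variable E : set R[i].
Hypotheses (E_closed : closed E) (E_circle : E `<=` @unit_circle R)
  (E_null : arc_length E = 0%E) (mu_supp : mu (~` E) = 0%E).

Let mE : measurable E := closed_measurableC E_closed.
Local Notation gap := (gap E_closed).
Local Notation gapl := (gapl E_closed).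
Local Notation gapr := (gapr E_closed).

Let measurable_gap k : measurable (gap k : set (measurableTypeR R)).
Proof. by apply: open_measurable; exact: open_disjoint_itv_open. Qed.

Let trivIset_gap : trivIset setT gap.
Proof. exact: open_disjoint_itv_trivIset. Qed.

Let bigcup_gap : gap_angles E = \bigcup_k gap k.
Proof. exact: open_disjoint_itv_bigcup. Qed.

Let gap_itv k : gap k `<=` `]0%R, (2 * pi)%R[%classic.
Proof. by move=> t /gap_sub[t02 _]; rewrite /= in_itv. Qed.

(** The angles outside the gaps are 0, [2 * pi] and the angles of [E], which
    form a null set. *)
Lemma integral_gap_angles (f : R -> \bar R) :
  measurable_fun setT (f : measurableTypeR R -> _) -> (forall t, 0 <= f t)%E ->
  (\int[leb]_(t in `[0%R, (2 * pi)%R]) f t =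
   \sum_(k <oo) \int[leb]_(t in gap k) f t)%E.
Proof.
move=> mf f0.
rewrite (@integral_itv_bndoo R 0 (2 * pi) f true false); last first.
  exact: measurable_funTS.
pose N : set R := [set t : R | 0 <= t < 2 * pi /\ E (expi t)].
have mN : measurable (N : set (measurableTypeR R)).
  rewrite (_ : N = `[0, 2 * pi[%classic `&` (@expi R) @^-1` E).
    apply: measurableI; first exact: measurable_itv.
    apply: closed_measurable.
    by have /continuous_closedP := @continuous_expi R; apply.
  by apply/seteqP; split => t /=; rewrite in_itv.
rewrite (ge0_negligible_integral mN)//; last exact: measurable_funTS.
rewrite -ge0_integral_bigcup//.
- congr (integral _ _ _); rewrite -bigcup_gap.
  apply/seteqP; split => t; rewrite /= in_itv /=.
    move=> [t02 nN]; split => // Et; apply: nN; split => //.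
    by case/andP : t02 => /ltW ->.
  by move=> [t02 nE]; split => // -[_].
- exact: measurable_funTS.
Qed.

(** Over one gap, the end weight integrates to a power of the length of the
    gap; the integrals of the potential over all the gaps add up to at most
    its integral over a period. *)
Lemma hardy_mean_le (p b s : R) (X : R -> R) (C : R)
    (f := fun t => ((X t) `^ p)%:E) : 0 < C -> 0 < b -> b < 1 ->
  measurable_fun setT (fun t : measurableTypeR R => (X t) `^ p) ->
  (forall k t, gap k t -> (f t <= C%:E * ((end_weight b (gapl k) (gapr k) t)%:E
      + riesz_potential mu E s t))%E) ->
  (\int[leb]_(t in `[0%R, (2 * pi)%R]) f t <=
   C%:E * ((2 / (1 - b))%:E * \sum_(k <oo) ((gapr k - gapl k) `^ (1 - b))%:E +
    \int[leb]_(t in `]0%R, (2 * pi)%R[) riesz_potential mu E s t))%E.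
Proof.
move=> C0 b0 b1 mX fle.
have f0 t : (0 <= f t)%E by rewrite lee_fin powR_ge0.
have mf : measurable_fun setT (f : measurableTypeR R -> _).
  by apply/measurable_EFinP.
have mH := measurable_riesz_potential mu mE s.
have H0 := riesz_potential_ge0 mu E s.
have mHk k : measurable_fun (gap k) (riesz_potential mu E s).
  by apply: measurable_funS mH => //; exact: gap_itv.
have w0 k t : (0 <= (end_weight b (gapl k) (gapr k) t)%:E)%E.
  by rewrite lee_fin end_weight_ge0.
have mw k :
    measurable_fun (gap k) (fun t => (end_weight b (gapl k) (gapr k) t)%:E).
  by apply/measurable_EFinP; exact: measurable_end_weight.
have mwH k : measurable_fun (gap k) (fun t : measurableTypeR R =>
    (end_weight b (gapl k) (gapr k) t)%:E + riesz_potential mu E s t)%E.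
  exact: (emeasurable_funD (mw k) (mHk k)).
have iH0 k : (0 <= \int[leb]_(t in gap k) riesz_potential mu E s t)%E.
  by apply: integral_ge0 => t _; exact: H0.
have b1' : 0 <= 1 - b by rewrite subr_ge0 ltW.
rewrite integral_gap_angles//.
apply: (@le_trans _ _ (\sum_(k <oo) (C%:E *
    (((2 / (1 - b))%:E * ((gapr k - gapl k) `^ (1 - b))%:E) +
     \int[leb]_(t in gap k) riesz_potential mu E s t)))%E).
  apply: lee_nneseries => [k _ _|k _]; first exact: integral_ge0.
  apply: (@le_trans _ _ (\int[leb]_(t in gap k)
    (C%:E * ((end_weight b (gapl k) (gapr k) t)%:E +
      riesz_potential mu E s t)))%E).
    apply: ge0_le_integral => //.
    - exact: measurable_funTS.
    - exact: (measurable_funeM _ (mwH k)).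
    - exact: fle.
  rewrite ge0_integralZl//; last 3 first.
  - exact: mwH.
  - by move=> t _; rewrite adde_ge0.
  - by rewrite lee_fin ltW.
  apply: lee_wpmul2l; first by rewrite lee_fin ltW.
  rewrite (ge0_integralD leb (measurable_gap k) (fun t _ => w0 k t) (mw k)
    (fun t _ => H0 t) (mHk k)); apply: leeD => //.
  rewrite -EFinM.
  have [kne|/nonemptyPn ->] := pselect (gap k !=set0); last first.
    by rewrite integral_set0 lee_fin mulr_ge0 ?powR_ge0// divr_ge0.
  have [_ lr _] := gap_bounds kne.
  rewrite {1}gapE (_ : [set t | _] = `]gapl k, gapr k[%classic).
    by apply: integral_end_weight => //; exact: ltW.
  by apply/seteqP; split => t /=; rewrite in_itv.
rewrite nneseriesZl; last first.
  move=> k _; rewrite adde_ge0// -EFinM lee_fin mulr_ge0 ?powR_ge0//.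
  by rewrite divr_ge0.
apply: lee_wpmul2l; first by rewrite lee_fin ltW.
rewrite nneseriesD; last 2 first.
- by move=> k _ _; rewrite -EFinM lee_fin mulr_ge0 ?powR_ge0// divr_ge0.
- by move=> k _ _.
rewrite nneseriesZl; last by move=> k _; rewrite lee_fin powR_ge0.
apply: leeD => //.
rewrite -ge0_integral_bigcup//; last first.
  exact/measurable_fun_bigcup.
apply: ge0_subset_integral => //.
- exact: bigcup_measurable.
- by move=> t [k _ /gap_itv].
Qed.
End circle_mean.

(** The relation between [b] and [s] is that of [powR_potential_le]: with
    [c = p / (1 - p)], it reads [2 - s = b / c], so that [0 < s < 1] means
    [c < b < 2 * c].  There is room for such a [b] below 1 and [q], as
    [p < 1 / 2] means [c < 1]. *)
Lemma exponent_choice (R : realType) (p q : R) : 0 < p -> p < 1 / 2 ->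
  p / (1 - p) < q -> exists b s : R,
  [/\ 0 < b, b < 1, b <= q, 0 < s < 1 & (2 - s) * p = b * (1 - p)].
Proof.
move=> p0 p12 pq.
have p1 : 0 < 1 - p by lra.
set c := p / (1 - p) in pq.
have c0 : 0 < c by rewrite divr_gt0.
have c1 : c < 1 by rewrite ltr_pdivrMr//; lra.
pose M := Num.min q (Num.min 1 (2 * c)).
have cM : c < M by rewrite !lt_min pq c1/=; lra.
have Mq : M <= q by rewrite ge_min lexx.
have M1 : M <= 1 by rewrite !ge_min lexx orbT.
have M2 : M <= 2 * c by rewrite !ge_min lexx !orbT.
have E1 : p = c * (1 - p) by rewrite divfK// gt_eqF.
clearbody M; clearbody c.
exists ((c + M) / 2), (2 - (c + M) / (2 * c)); split; try lra.
- apply/andP; split.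
    by rewrite subr_gt0 ltr_pdivrMr ?mulr_gt0//; lra.
  by rewrite ltrBlDr -ltrBlDl ltr_pdivlMr ?mulr_gt0//; lra.
- rewrite opprB addrC subrK {1}E1; field; rewrite gt_eqF//.
Qed.

Theorem theorem5p1 (R : realType) (p : R) (p_gt0 : 0 < p) (p_lt : p < 1 / 2)
    (mu : {finite_measure set R[i] -> \bar R}) (E : set R[i])
    (E_closed : closed E) (E_circle : E `<=` @unit_circle R)
    (E_null : arc_length E = 0%E) (mu_supp : mu (~` E) = 0%E)
    (arcs_sum : exists2 q : R, p / (1 - p) < q &
      (\esum_(J in complementary_arcs E) (arc_length J `^ (1 - q)) < +oo)%E) :
  hardy p (derive1 (singular_inner mu)).
Proof.
split.
  move=> z; rewrite unit_diskE => z1.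
  by have [l []] := is_cderiv_derive1_singular_inner mu z1.
have [q pq sumJ] := arcs_sum.
have [b [s [b0 b1 bq /andP[s0 s1] sb]]] := exponent_choice p_gt0 p_lt pq.
have p1 : p < 1 by lra.
have mE := closed_measurableC E_closed.
pose C : R := (16 * 2 `^ (2 - s)) `^ p.
have C0 : 0 < C by rewrite powR_gt0 ?mulr_gt0 ?powR_gt0.
pose S := (\sum_(k <oo) ((gapr E_closed k - gapl E_closed k) `^ (1 - b))%:E)%E.
pose I := (\int[lebesgue_measure]_(t in `]0%R, (2 * pi)%R[)
  riesz_potential mu E s t)%E.
have S0 : (0 <= S)%E by apply: nneseries_ge0 => k _ _; rewrite lee_fin powR_ge0.
have I0 : (0 <= I)%E by apply: integral_ge0 => t _; exact: riesz_potential_ge0.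
have Soo : (S < +oo)%E := gaps_summable E_closed b1 bq sumJ.
have Ioo : (I < +oo)%E := integral_riesz_potential mu mE E_circle s0 s1.
have b1' : 0 <= 1 - b by rewrite subr_ge0 ltW.
pose B := (((2 * pi)^-1)%:E * (C%:E * ((2 / (1 - b))%:E * S + I)))%E.
apply: (@le_lt_trans _ _ B); last first.
  have SI0 : (0 <= (2 / (1 - b))%:E * S + I)%E.
    by rewrite adde_ge0// mule_ge0// lee_fin divr_ge0.
  rewrite /B lte_mul_pinfty ?lee_fin ?invr_ge0 ?mulr_ge0 ?pi_ge0//.
  rewrite lte_mul_pinfty ?lee_fin ?(ltW C0)//.
  by rewrite lte_add_pinfty// lte_mul_pinfty// lee_fin divr_ge0.
apply: ge_ereal_sup => _ [r r01 <-].
rewrite /B; apply: lee_wpmul2l.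
  by rewrite lee_fin invr_ge0 mulr_ge0 ?pi_ge0.
apply: (@hardy_mean_le R mu E E_closed E_null p b s
  (fun t => Normc.normc
    (derive1 (singular_inner mu) (real_complex R r * expi t)))) => //.
  exact: measurable_radial.
move=> k t kt.
have /andP[lt tr] : gapl E_closed k < t < gapr E_closed k.
  by move: kt; rewrite gapE.
set m := Num.min (t - gapl E_closed k) (gapr E_closed k - t).
have m0 : 0 < m by rewrite lt_min !subr_gt0 lt.
have mdist a : E a -> m / 2 <= Normc.normc (expi t - a).
  by move=> Ea; exact: (gap_dist E_circle kt Ea).
have H0 := riesz_potential_ge0 mu E s t.
apply: (le_trans (powR_potential_le p_gt0 p1 _ m0 H0 sb
  (derive1_singular_inner_le_potential E_closed E_circle mu_supp r01 s1 m0
    mdist))).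
  exact: normc_ge0.
apply: lee_wpmul2l; first by rewrite lee_fin ltW.
by apply: leeD => //; rewrite lee_fin powR_min_le.
Qed.
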